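(* Suppose that for all $c\in\mathbb{N}^+$ and all $\gamma>0$, as $n\to\infty$, $$\sup\left\{\frac{|f|_{\mathcal{C}}}{|f|_{\mathcal{U}^c}}: f\in H^n,\ |f|_{\mathcal{U}^c}<+\infty\right\}\in O(n^{1+\gamma}).$$ Then $\mathbf{P}\neq\mathbf{NP}$.
   Context: Let $\mathcal{B}=\{0,1\}$, let $\mathcal{B}^*$ be the set of finite binary strings and $|h|$ the length of $h\in\mathcal{B}^*$. For $n\in\mathbb{N}^+$, $H^n$ is the set of all functions $\mathcal{B}^n\to\mathcal{B}$. An interpreter is a Turing machine computing a partial function $\varphi:\mathcal{B}^*\times\mathcal{B}^*\to\mathcal{B}\cup\{\bot\}$, where $\bot$ denotes non-halting (or invalid) output. For $f\in H^n$, $|f|_\varphi=\min\{|h|:\varphi(h,x)=f(x)\ \forall x\in\mathcal{B}^n\}$ ($+\infty$ if no such $h$). Turing machines have alphabet $\{0,1,b\}$ ($b$ blank), a finite state set containing an initial state and two final states accept/reject; the output is $1$ if halting in accept, $0$ if halting in reject, $\bot$ otherwise; multi-tape machines have read-only input tapes and read/write work tapes, and the transition function is a finite list of rules. $E(T)$ is a fixed prefix-free binary encoding of a machine $T$ listing its rules (of length at least 2 for every machine). For $c\in\mathbb{N}^+$, $\mathcal{U}^c$ is a time-bounded universal interpreter (a 2-input-tape, 3-work-tape machine): on $(p,x)$ with $n=|x|$, it checks within $n^c$ steps whether $p=E(T)u$ for a two-input-tape machine $T$ and $u\in\mathcal{B}^*$ (outputting $\bot$ if not, or if the check does not finish), then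 simulates $T$ on $(u,x)$ with an efficient universal simulation (Hennie–Stearns, overhead $O(t\log t)$ for $t$ simulated steps), devoting at most $n^c$ of its own steps to the simulation; it outputs $T$'s output if $T$ halts within this budget and $0$ otherwise. For fixed $p$ it runs in at most $\beta n^c$ steps for a constant $\beta$. In particular, if a Turing machine computes $g:\mathcal{B}^*\to\mathcal{B}$ in time $O(n^{c'})$ with $c'<c$, there is $h\in\mathcal{B}^*$ with $\mathcal{U}^c(h,x)=g(x)$ for all $x$ of sufficiently large length. A Boolean circuit on $n$ inputs is a DAG with a unique sink (output) whose sources are labelled by input indices in $\{1,\dots,n\}$ and whose other vertices (gates) are labelled AND, OR (two incoming edges) or NOT (one incoming edge); its size $|C|$ is its number of vertices. The circuit interpreter $\mathcal{C}$ reads a program $h=0^{\lceil\log_2 n\rceil}1\,[\text{binary expansion of } n]\,0^{|C|}1\,[\text{description of vertex } i]_{i=1}^{|C|}$, each vertex being described by its label and its parents/input index using $\max\{2\lceil\log_2|C|\rceil,\lceil\log_2 n\rceil\}$ bits beyond the label bits, so a circuit $C$ on $n$ inputs has encoding length $L(|C|,n)=2\lceil\log_2 n\rceil+2+|C|(3+\max\{2\lceil\log_2|C|\rceil,\lceil\log_2 n\rceil\})$; $\mathcal{C}(h,x)$ is the circuit's output on $x\in\mathcal{B}^n$, and $\bot$ if $h$ is malformed. Hence $|f|_{\mathcal{C}}=\min\{L(|C|,n): C \text{ computes } f\}$. $\mathbf{P}$ and $\mathbf{NP}$ are the usual complexity classes. *)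

(* Defs.v *)
From mathcomp Require Import all_boot.
From Stdlib Require Import Reals.

Set Implicit Arguments.
Unset Strict Implicit.
Unset Printing Implicit Defensive.

(* None is the blank symbol b. *)
Definition Sym := option bool.

Inductive Dir := DLeft | DRight | DStay.

Definition q_init := 0.
Definition q_acc := 1.
Definition q_rej := 2.

Record rule := Rule {
  r_q : nat;
  r_in : seq Sym;
  r_work : seq Sym;
  r_q' : nat;
  r_inmv : seq Dir;
  r_write : seq Sym;
  r_workmv : seq Dir
}.

Record TM := MkTM { tm_nwork : nat; tm_rules : seq rule }.

(* A work tape as a zipper: reversed left part, current cell, right part. *)
Record tape := Tape { t_left : seq Sym; t_cur : Sym; t_right : seq Sym }.

Definition blank_tape := Tape [::] None [::].

Definition write_move (s : Sym) (d : Dir) (t : tape) : tape :=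
  match d with
  | DStay => Tape (t_left t) s (t_right t)
  | DLeft => match t_left t with
             | [::] => Tape [::] None (s :: t_right t)
             | a :: l => Tape l a (s :: t_right t)
             end
  | DRight => match t_right t with
              | [::] => Tape (s :: t_left t) None [::]
              | a :: r => Tape (s :: t_left t) a r
              end
  end.

Definition move_pos (d : Dir) (p : nat) : nat :=
  match d with DLeft => p.-1 | DRight => p.+1 | DStay => p end.

Definition read_input (x : seq bool) (p : nat) : Sym := nth None (map Some x) p.

Record cfg := Cfg { c_q : nat; c_ipos : seq nat; c_work : seq tape }.

Definition init_cfg (M : TM) (xs : seq (seq bool)) : cfg :=
  Cfg q_init (nseq (size xs) 0) (nseq (tm_nwork M) blank_tape).

Definition rule_matches (xs : seq (seq bool)) (C : cfg) (r : rule) : bool :=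
  let ins := [seq read_input xp.1 xp.2 | xp <- zip xs (c_ipos C)] in
  let wks := map t_cur (c_work C) in
  [&& r_q r == c_q C, r_in r == ins, r_work r == wks,
      size (r_inmv r) == size ins, size (r_write r) == size wks
    & size (r_workmv r) == size wks].

Definition step (M : TM) (xs : seq (seq bool)) (C : cfg) : cfg :=
  if (c_q C == q_acc) || (c_q C == q_rej) then C else
  match ohead [seq r <- tm_rules M | rule_matches xs C r] with
  | None => C
  | Some r =>
      Cfg (r_q' r)
          [seq move_pos dp.1 dp.2 | dp <- zip (r_inmv r) (c_ipos C)]
          [seq write_move sdt.1.1 sdt.1.2 sdt.2
             | sdt <- zip (zip (r_write r) (r_workmv r)) (c_work C)]
  end.

Definition run (M : TM) (xs : seq (seq bool)) (t : nat) : cfg :=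
  iter t (step M xs) (init_cfg M xs).

Definition outcome (M : TM) (xs : seq (seq bool)) (t : nat) : option bool :=
  let q := c_q (run M xs t) in
  if q == q_acc then Some true else if q == q_rej then Some false else None.

Definition computes_in_time (M : TM) (g : seq bool -> bool) (d : nat) : Prop :=
  exists K : nat, forall x : seq bool,
    exists t, t <= K * (size x) ^ d + K /\ outcome M [:: x] t = Some (g x).

Definition language := seq bool -> bool.

Definition P_class : language -> Prop :=
  fun L => exists (M : TM) (d : nat), computes_in_time M L d.

Definition NP_class : language -> Prop :=
  fun L => exists (V : TM) (d K : nat),
    (forall x w : seq bool, exists t,
        t <= K * (size x + size w) ^ d + K /\ outcome V [:: x; w] t <> None) /\
    (forall x : seq bool,
        L x <-> exists w : seq bool, size w <= K * (size x) ^ d + K /\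
                  exists t, outcome V [:: x; w] t = Some true).

(* Boolean circuits (vertices listed in a topological order;           *)
(* input indices are 0-based, i.e. label i+1 in the paper).            *)

Inductive gate := GIn of nat | GAnd of nat & nat | GOr of nat & nat | GNot of nat.

Definition circuit := seq gate.

Definition gate_ok (n k : nat) (g : gate) : bool :=
  match g with
  | GIn i => i < n
  | GAnd a b | GOr a b => [&& a < k, b < k & a != b]
  | GNot a => a < k
  end.

Definition gate_parent (g : gate) (j : nat) : bool :=
  match g with
  | GIn _ => false
  | GAnd a b | GOr a b => (a == j) || (b == j)
  | GNot a => a == j
  end.

(* Well-formed DAG with a unique sink (the last vertex). *)
Definition wf_circuit (n : nat) (C : circuit) : bool :=
  [&& 0 < size C,
      all (fun k => gate_ok n k (nth (GIn 0) C k)) (iota 0 (size C))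
    & all (fun j => has (fun k => gate_parent (nth (GIn 0) C k) j)
                        (iota j.+1 (size C - j.+1)))
          (iota 0 (size C).-1)].

Definition eval_gate (x : seq bool) (vals : seq bool) (g : gate) : bool :=
  match g with
  | GIn i => nth false x i
  | GAnd a b => nth false vals a && nth false vals b
  | GOr a b => nth false vals a || nth false vals b
  | GNot a => ~~ nth false vals a
  end.

Definition circ_out (C : circuit) (x : seq bool) : bool :=
  last false (foldl (fun vals g => rcons vals (eval_gate x vals g)) [::] C).

Definition circ_computes (n : nat) (C : circuit) (f : n.-tuple bool -> bool) : Prop :=
  wf_circuit n C /\ forall x : n.-tuple bool, circ_out C x = f x.

(* Encoding length L(|C|, n); up_log 2 m = ceil(log2 m). *)
Definition circ_len (s n : nat) : nat :=
  2 * up_log 2 n + 2 + s * (3 + maxn (2 * up_log 2 s) (up_log 2 n)).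

Definition is_min (P : nat -> Prop) (m : nat) : Prop :=
  P m /\ forall k, P k -> m <= k.

(* An interpreter: None stands for bottom. *)
Definition interpreter := seq bool -> seq bool -> option bool.

Definition prog_len (phi : interpreter) (n : nat) (f : n.-tuple bool -> bool) (m : nat) : Prop :=
  exists h : seq bool, size h = m /\ forall x : n.-tuple bool, phi h x = Some (f x).

Definition circ_desc_len (n : nat) (f : n.-tuple bool -> bool) (m : nat) : Prop :=
  exists C : circuit, circ_computes C f /\ circ_len (size C) n = m.

(* Main.v *)
Require Import Defs.
From mathcomp Require Import all_boot.
From Stdlib Require Import Reals.
From Stdlib Require Import Lra Znat.
From mathcomp Require Import boolp zify.
(* [Reals] rebinds the notation of nat powers to [Nat.pow]; this restores [expn]. *)
From mathcomp Require Import ssrnat.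

Set Implicit Arguments.
Unset Strict Implicit.
Unset Printing Implicit Defensive.

(** Assume P = NP. Call a language "sigma11" if it is defined by an existential
    quantifier over a bit sequence followed by a bounded arithmetic formula.
    Bounded formulas are evaluated by polynomial-time counter machines, so
    sigma11 languages are in NP; tableaux of computations show conversely that
    every language in P, together with its complement, is sigma11. Hence under
    P = NP the sigma11 languages are closed under complement, and Kannan's
    argument applies: the lexicographically first truth table (on the inputs of
    length n with exactly three ones) that no circuit of size n^(4/3) computes
    is decidable in P. Such a table exists by counting for n = 3 q^3. The
    hypothesis with gamma = 1/6 bounds the circuit size of every language in P
    by O(n^(7/6)), which is at most n^(4/3) for large n: a contradiction. *)

(** * Bounded formulas and polynomial bounds *)

(** Conjunctions, quantifiers over strings and the substitution of a guessed string are syntactic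
    operations on formulas, so one compiler and one tableau are the only contact with the machine
    model. Inputs with three ones are a compromise. Their table is a string of length n^3, short
    enough to be guessed by a polynomial verifier, yet it has order n^3 independent entries, while a
    circuit of size s, written as Boolean matrices, takes O(s^2 + s n) bits, that is O(n^(8/3)) for
    s up to n^(4/3). The exponent 4/3 lies between 7/6, which the hypothesis yields, and 3/2, where
    s^2 reaches n^3. The collapse is used three times: to make hardness existential, to make
    minimality among the hard tables existential, and to bring the resulting language from NP into
    P. The program given by universality is the same for all long inputs, so the description length
    under the universal interpreter is bounded by a constant, and the bound on the ratio becomes a
    bound on circuit size. *)

Definition pbounded (f : nat -> nat) := exists c, forall m, f m <= (m + 2) ^ c.

Lemma pbounded_le (f g : nat -> nat) :
  pbounded g -> (forall m, f m <= g m) -> pbounded f.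
Proof. by move=> [c Hc] H; exists c => m; exact: leq_trans (H m) (Hc m). Qed.

Lemma leq_pow2 a b k : a <= b -> (k + 2) ^ a <= (k + 2) ^ b.
Proof. by move=> H; rewrite leq_pexp2l // addn2. Qed.

Lemma pow2_ge a k : 2 ^ a <= (k + 2) ^ a.
Proof. by case: a => // a; rewrite leq_exp2r // leq_addl. Qed.

Lemma pbounded_const k : pbounded (fun=> k).
Proof.
exists k => m; apply: leq_trans (pow2_ge k m).
by apply: ltnW; apply: ltn_expl.
Qed.

Lemma pbounded_id : pbounded (fun m => m).
Proof. by exists 1 => m; rewrite expn1 leq_addr. Qed.

(** With base [m + 2] one more factor is at least 2, which absorbs the sum of two powers. *)
Lemma pbounded_add f g : pbounded f -> pbounded g -> pbounded (fun m => f m + g m).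
Proof.
move=> [a Ha] [b Hb]; exists (maxn a b).+1 => m.
rewrite expnS; have h1 := leq_pow2 m (leq_maxl a b).
have h2 := leq_pow2 m (leq_maxr a b).
apply: leq_trans (leq_add (leq_trans (Ha m) h1) (leq_trans (Hb m) h2)) _.
by rewrite addnn -mul2n leq_mul2r leq_addl orbT.
Qed.

Lemma pbounded_mul f g : pbounded f -> pbounded g -> pbounded (fun m => f m * g m).
Proof.
by move=> [a Ha] [b Hb]; exists (a + b) => m; rewrite expnD; exact: leq_mul.
Qed.

Lemma pbounded_comp f g : pbounded f -> pbounded g -> pbounded (fun m => f (g m)).
Proof.
move=> [a Ha] [b Hb]; exists (b.+2 * a) => m.
apply: leq_trans (Ha _) _; rewrite expnM.
case: a {Ha} => // a; rewrite leq_exp2r //.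
apply: (@leq_trans ((m + 2) ^ b + 2)); first by rewrite leq_add2r.
have : 0 < (m + 2) ^ b by rewrite expn_gt0 addn2.
rewrite !expnS; move: ((m + 2) ^ b) => y Hy; nia.
Qed.

(** Powers in the definitions of the classes are [Nat.pow], those in this proof are [expn]. *)
Lemma Nat_powE m n : Nat.pow m n = m ^ n.
Proof. by elim: n => //= n ->; rewrite expnS. Qed.

(** This is the shape of the bounds in [NP_class]: [m + 2 <= 3 * m] for positive [m], and the
    summand [K] covers [m = 0]. *)
Lemma pbounded_NP_form f : pbounded f ->
  exists K d, forall m, f m <= K * m ^ d + K.
Proof.
move=> [c Hc]; exists (3 ^ c), c => m; apply: leq_trans (Hc m) _.
case: m => [|m]; first by rewrite add0n (leq_trans _ (leq_addl _ _)) //; case: c {Hc} => // c; rewrite leq_exp2r.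
apply: leq_trans (leq_addr _ _); rewrite -expnMn; case: c {Hc} => // c.
rewrite leq_exp2r //; lia.
Qed.

Definition upd (s : nat -> nat) (v k : nat) : nat -> nat :=
  fun u => if u == v then k else s u.

(** Terms are polynomials with natural coefficients, so their values, and with them the ranges of
    the quantifiers [FEx], stay polynomially bounded and can be searched exhaustively. *)
Inductive term :=
  | TVar of nat | TNum of nat | TLen | TAdd of term & term | TMul of term & term.

Inductive fml :=
  | FLt of term & term
  | FBit of bool & term
  | FNot of fml
  | FAnd of fml & fml
  | FEx of nat & term & fml.

Fixpoint teval (n : nat) (e : nat -> nat) (t : term) : nat :=
  match t with
  | TVar v => e v
  | TNum k => k
  | TLen => n
  | TAdd a b => teval n e a + teval n e b
  | TMul a b => teval n e a * teval n e b
  end.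

(* [FBit false] reads the input, [FBit true] the second-order witness [W]. *)
Fixpoint feval (x : seq bool) (W : nat -> bool) (e : nat -> nat) (f : fml) : bool :=
  match f with
  | FLt a b => teval (size x) e a < teval (size x) e b
  | FBit b t => if b then W (teval (size x) e t) else nth false x (teval (size x) e t)
  | FNot g => ~~ feval x W e g
  | FAnd g h => feval x W e g && feval x W e h
  | FEx v t g => has (fun k => feval x W (upd e v k) g) (iota 0 (teval (size x) e t))
  end.

Fixpoint tbound (t : term) : nat :=
  match t with
  | TVar v => v.+1
  | TNum _ | TLen => 0
  | TAdd a b | TMul a b => maxn (tbound a) (tbound b)
  end.

(** Bound variables are counted too: all registers from [fbound f + 2] on are then free as scratch
    space for the compiled formula. *)
Fixpoint fbound (f : fml) : nat :=
  match f with
  | FLt a b => maxn (tbound a) (tbound b)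
  | FBit _ t => tbound t
  | FNot g => fbound g
  | FAnd g h => maxn (fbound g) (fbound h)
  | FEx v t g => maxn v.+1 (maxn (tbound t) (fbound g))
  end.

Lemma teval_ext n e e' t :
  (forall v, v < tbound t -> e v = e' v) -> teval n e t = teval n e' t.
Proof.
elim: t => //= [v H|a IHa b IHb H|a IHa b IHb H]; first exact: H.
- by rewrite IHa ?IHb // => v hv; apply: H; rewrite leq_max hv ?orbT.
- by rewrite IHa ?IHb // => v hv; apply: H; rewrite leq_max hv ?orbT.
Qed.

Lemma feval_ext x W e e' f :
  (forall v, v < fbound f -> e v = e' v) -> feval x W e f = feval x W e' f.
Proof.
elim: f e e' => /= [a b|b t|g IH|g IHg h IHh|v t g IH] e e' H.
- by rewrite !(@teval_ext _ e e') // => v hv; apply: H; rewrite leq_max hv ?orbT.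
- by rewrite !(@teval_ext _ e e').
- by rewrite (IH e e').
- by rewrite (IHg e e') ?(IHh e e') // => u hu; apply: H; rewrite leq_max hu ?orbT.
rewrite (@teval_ext _ e e') => [|u hu]; last by apply: H; rewrite !leq_max hu ?orbT.
apply: eq_has => k; apply: IH => u hu; rewrite /upd; case: eqP => // _.
by apply: H; rewrite !leq_max hu ?orbT.
Qed.

Lemma teval_bound t : exists2 g, pbounded g &
  forall n e m, n <= m -> (forall v, e v <= m) -> teval n e t <= g m.
Proof.
elim: t => /= [v|k||a [f Pf Hf] b [g Pg Hg]|a [f Pf Hf] b [g Pg Hg]].
- by exists (fun m => m); [exact: pbounded_id|move=> n e m _].
- by exists (fun=> k); [exact: pbounded_const|].
- by exists (fun m => m); [exact: pbounded_id|].
- exists (fun m => f m + g m); first exact: pbounded_add.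
  by move=> n e m h1 h2; apply: leq_add; auto.
- exists (fun m => f m * g m); first exact: pbounded_mul.
  by move=> n e m h1 h2; apply: leq_mul; auto.
Qed.

Lemma pbounded_maxn f g : pbounded f -> pbounded g -> pbounded (fun m => maxn (f m) (g m)).
Proof.
move=> Pf Pg; apply: pbounded_le (pbounded_add Pf Pg) _ => m.
by rewrite geq_max leq_addr leq_addl.
Qed.

(** This lets a finite certificate replace the infinite witness. Below a quantifier the values of
    variables may grow to [m + u m], hence the composition of bounds. *)
Lemma feval_local f : exists2 g, pbounded g &
  forall x W W' e m, size x <= m -> (forall v, e v <= m) ->
    (forall i, i < g m -> W i = W' i) -> feval x W e f = feval x W' e f.
Proof.
elim: f => /= [a b|b t|g [f Pf Hf]|g [f Pf Hf] h [f' Pf' Hf']|v t g [f Pf Hf]].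
- by exists (fun=> 0); [exact: pbounded_const|].
- have [g Pg Hg] := teval_bound t.
  exists (fun m => g m + 1); first by apply: pbounded_add => //; exact: pbounded_const.
  by move=> x W W' e m h1 h2 h3; case: b => //; apply: h3; rewrite addn1 ltnS; exact: Hg.
- by exists f => // x W W' e m h1 h2 h3; rewrite (Hf x W W' e m).
- exists (fun m => maxn (f m) (f' m)); first exact: pbounded_maxn.
  move=> x W W' e m h1 h2 h3; rewrite (Hf x W W' e m) ?(Hf' x W W' e m) // => i hi;
  by apply: h3; rewrite leq_max hi ?orbT.
- have [u Pu Hu] := teval_bound t.
  exists (fun m => f (m + u m)).
    by apply: pbounded_comp => //; apply: pbounded_add => //; exact: pbounded_id.
  move=> x W W' e m h1 h2 h3; apply: eq_in_has => k; rewrite mem_iota add0n /= => hk.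
  apply: (Hf _ _ _ _ (m + u m)) => //; first exact: leq_trans h1 (leq_addr _ _).
  move=> y; rewrite /upd; case: eqP => _; last exact: leq_trans (h2 _) (leq_addr _ _).
  apply: leq_trans (leq_addl _ _); apply: ltnW; apply: leq_trans hk _; exact: Hu.
Qed.

(** * Counter programs *)

(** Each test depends on a single scanned symbol, so that a machine decides it within one
    transition. *)
Inductive test := CNZ of nat | CSome of bool | CTrue of bool.

Inductive prog :=
  | Inc of nat
  | Dec of nat
  | Seq of prog & prog
  | If of test & prog & prog
  | While of test & prog.

Definition input (x w : seq bool) (b : bool) : seq bool := if b then w else x.

(* Registers 0 and 1 are the head positions on the two input tapes, the
   others are counters; only the counters can be tested for zero. *)
Definition holds (x w : seq bool) (c : test) (s : nat -> nat) : bool :=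
  match c with
  | CNZ v => s v != 0
  | CSome b => s b < size (input x w b)
  | CTrue b => nth false (input x w b) (s b)
  end.

(* The last argument bounds the running time. *)
Inductive exec (x w : seq bool) : prog -> (nat -> nat) -> (nat -> nat) -> nat -> Prop :=
  | X_Inc v s : exec x w (Inc v) s (upd s v (s v).+1) 1
  | X_Dec v s : exec x w (Dec v) s (upd s v (s v).-1) 1
  | X_Seq p q s1 s2 s3 t t' : exec x w p s1 s2 t -> exec x w q s2 s3 t' ->
      exec x w (Seq p q) s1 s3 (t + t')
  | X_IfT c p q s s' t : holds x w c s -> exec x w p s s' t ->
      exec x w (If c p q) s s' t.+1
  | X_IfF c p q s s' t : ~~ holds x w c s -> exec x w q s s' t ->
      exec x w (If c p q) s s' t.+1
  | X_WhileT c p s1 s2 s3 t t' : holds x w c s1 -> exec x w p s1 s2 t ->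
      exec x w (While c p) s2 s3 t' -> exec x w (While c p) s1 s3 (t + t').+1
  | X_WhileF c p s : ~~ holds x w c s -> exec x w (While c p) s s 1
  | X_weak p s s' t t' : exec x w p s s' t -> t <= t' -> exec x w p s s' t'.

Lemma exec_eq x w p s s' s'' t t' :
  exec x w p s s' t -> s' =1 s'' -> t <= t' -> exec x w p s s'' t'.
Proof. by move=> H /funext <- le; exact: X_weak H le. Qed.

(** [I k] is the complete register state after [k] rounds; giving it in closed form reduces a loop
    to one check per round. *)
Lemma exec_loop x w c p (I : nat -> nat -> nat) n T :
  (forall k, k < n -> holds x w c (I k)) -> ~~ holds x w c (I n) ->
  (forall k, k < n -> exec x w p (I k) (I k.+1) T) ->
  exec x w (While c p) (I 0) (I n) (n * T.+1 + 1).
Proof.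
elim: n I => [|n IH] I Ht Hf Hb; first exact: X_WhileF.
apply: (@X_weak _ _ _ _ _ (T + (n * T.+1 + 1)).+1); last by rewrite mulSn; lia.
apply: X_WhileT (Ht 0 _) (Hb 0 _) _ => //.
by apply: (IH (fun k => I k.+1)) => // k hk; [apply: Ht|apply: Hb].
Qed.

Ltac upd_case := rewrite /upd /=; intros;
  repeat (match goal with |- context [if ?a == ?b then _ else _] =>
    case: (@eqP _ a b) => ? /= end);
  subst; try done; try lia.
Ltac upd_solve := let u := fresh "u" in move=> u; upd_case.

Definition move_cnt a b := While (CNZ a) (Seq (Dec a) (Inc b)).

Lemma exec_move x w a b s : a <> b ->
  exec x w (move_cnt a b) s (upd (upd s a 0) b (s b + s a)) (3 * s a + 1).
Proof.
move=> ab.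
pose I k := upd (upd s a (s a - k)) b (s b + k).
apply: (@exec_eq _ _ _ _ (I (s a)) _ (s a * 3 + 1)); [|by rewrite /I; upd_solve|lia].
have {1}-> : s = I 0 by apply: funext; rewrite /I; upd_solve.
apply: exec_loop => [k|| k hk]; rewrite /I /=; [by upd_case|by upd_case|].
apply: exec_eq; first by apply: X_Seq; [exact: X_Dec|exact: X_Inc].
- by upd_solve.
- by [].
Qed.

Definition move_cnt2 a b c := While (CNZ a) (Seq (Dec a) (Seq (Inc b) (Inc c))).

Lemma exec_move2 x w a b c s : a <> b -> a <> c -> b <> c ->
  exec x w (move_cnt2 a b c) s
    (upd (upd (upd s a 0) b (s b + s a)) c (s c + s a)) (4 * s a + 1).
Proof.
move=> ab ac bc.
pose I k := upd (upd (upd s a (s a - k)) b (s b + k)) c (s c + k).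
apply: (@exec_eq _ _ _ _ (I (s a)) _ (s a * 4 + 1)); [|by rewrite /I; upd_solve|lia].
have {1}-> : s = I 0 by apply: funext; rewrite /I; upd_solve.
apply: exec_loop => [k|| k hk]; rewrite /I /=; [by upd_case|by upd_case|].
apply: exec_eq.
- by apply: X_Seq; [exact: X_Dec|apply: X_Seq; exact: X_Inc].
- by upd_solve.
- by [].
Qed.

(* Used with [c] a head position: moves the head back while transferring [a] to [b]. *)
Definition unwind a b c := While (CNZ a) (Seq (Dec a) (Seq (Inc b) (Dec c))).

Lemma exec_unwind x w a b c s : a <> b -> a <> c -> b <> c ->
  exec x w (unwind a b c) s
    (upd (upd (upd s a 0) b (s b + s a)) c (s c - s a)) (4 * s a + 1).
Proof.
move=> ab ac bc.
pose I k := upd (upd (upd s a (s a - k)) b (s b + k)) c (s c - k).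
apply: (@exec_eq _ _ _ _ (I (s a)) _ (s a * 4 + 1)); [|by rewrite /I; upd_solve|lia].
have {1}-> : s = I 0 by apply: funext; rewrite /I; upd_solve.
apply: exec_loop => [k|| k hk]; rewrite /I /=; [by upd_case|by upd_case|].
apply: exec_eq.
- by apply: X_Seq; [exact: X_Dec|apply: X_Seq; [exact: X_Inc|exact: X_Dec]].
- by upd_solve.
- by [].
Qed.

Definition clear a := While (CNZ a) (Dec a).

Lemma exec_clear x w a s : exec x w (clear a) s (upd s a 0) (2 * s a + 1).
Proof.
pose I k := upd s a (s a - k).
apply: (@exec_eq _ _ _ _ (I (s a)) _ (s a * 2 + 1)); [|by rewrite /I; upd_solve|lia].
have {1}-> : s = I 0 by apply: funext; rewrite /I; upd_solve.
apply: exec_loop => [k|| k hk]; rewrite /I /=; [by upd_case|by upd_case|].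
by apply: exec_eq; [exact: X_Dec|upd_solve|].
Qed.

Definition scan r := While (CSome false) (Seq (Inc 0) (Inc r)).

Lemma exec_scan x w r s : r <> 0 -> s 0 = 0 ->
  exec x w (scan r) s (upd (upd s 0 (size x)) r (s r + size x)) (3 * size x + 1).
Proof.
move=> r0 s0.
pose I k := upd (upd s 0 k) r (s r + k).
apply: (@exec_eq _ _ _ _ (I (size x)) _ (size x * 3 + 1)); [|by rewrite /I; upd_solve|lia].
have {1}-> : s = I 0 by apply: funext; rewrite /I; upd_solve.
apply: exec_loop => [k|| k hk]; rewrite /I /=; [by upd_case|by upd_case|].
apply: exec_eq.
- by apply: X_Seq; exact: X_Inc.
- by upd_solve.
- by [].
Qed.

(** The result goes to register [r], scratch space lies from [r] upwards, and variable [v] lives in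
    register [v + 2], after the two heads. Reading a counter destroys it, so a value is copied to
    two registers and one copy is moved back. *)
Fixpoint tprog (t : term) (r : nat) : prog :=
  match t with
  | TVar v => Seq (move_cnt2 v.+2 r r.+1) (move_cnt r.+1 v.+2)
  | TNum k => iter k (fun p => Seq p (Inc r)) (clear r)
  | TLen => Seq (scan r) (Seq (unwind r r.+1 0) (move_cnt r.+1 r))
  | TAdd a b => Seq (tprog a r) (Seq (tprog b r.+1) (move_cnt r.+1 r))
  | TMul a b =>
      Seq (tprog a r.+1) (Seq (tprog b r.+2)
        (Seq (While (CNZ r.+1) (Seq (Dec r.+1)
                (Seq (move_cnt2 r.+2 r r.+3) (move_cnt r.+3 r.+2))))
             (clear r.+2)))
  end.

(** The calling convention of compiled code: zeroed scratch registers, both heads at the start, and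
    a bound [m] on all values from which running times are computed. *)
Definition ready (r m : nat) (x : seq bool) (s : nat -> nat) :=
  [/\ forall v, r <= v -> s v = 0, s 0 = 0, s 1 = 0, forall v, s v <= m & size x <= m].

Lemma ready_upd r r' m m' x s k : ready r m x s -> 2 <= r -> r' > r -> k + m <= m' ->
  ready r' m' x (upd s r k).
Proof.
case=> h1 h2 h3 h4 h5 r2 rr hk; split.
- by move=> v hv; rewrite /upd; case: eqP => [e|_]; [lia|apply: h1; lia].
- by upd_case.
- by upd_case.
- by move=> v; rewrite /upd; case: eqP => // _; [lia|have := h4 v; lia].
- by lia.
Qed.

Lemma ready_le r r' m m' x s : ready r m x s -> r <= r' -> m <= m' -> ready r' m' x s.
Proof.
case=> h1 h2 h3 h4 h5 hr hm; split=> // [v hv|v|]; last by lia.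
- by apply: h1; lia.
- by have := h4 v; lia.
Qed.

Ltac pb := repeat first
  [ assumption | exact: pbounded_id | exact: pbounded_const
  | apply: pbounded_add | apply: pbounded_mul ].

Lemma exec_tprog t : exists2 f, pbounded f & forall r m x w s,
  tbound t + 2 <= r -> ready r m x s ->
  exec x w (tprog t r) s (upd s r (teval (size x) (fun v => s v.+2) t)) (f m).
Proof.
elim: t => [v|k||a [f Pf Hf] b [g Pg Hg]|a [f Pf Hf] b [g Pg Hg]] /=.
- exists (fun m => 7 * m + 2); first by pb.
  move=> r m x w s hr [h1 h2 h3 h4 h5].
  have := h1 r (leqnn _); have := h1 r.+1 (leqnSn _); have := h4 v.+2 => e1 e2 e3.
  apply: exec_eq.
  + by apply: X_Seq; [apply: exec_move2; lia|apply: exec_move; lia].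
  + by upd_solve.
  + by upd_case.
- exists (fun m => k + 1); first by pb.
  move=> r m x w s hr [h1 h2 h3 h4 h5]; have e1 := h1 r (leqnn _).
  elim: k => [|k IH] /=.
  + by apply: exec_eq; [exact: exec_clear|upd_solve|rewrite e1].
  + by apply: exec_eq; [apply: X_Seq; [exact: IH|exact: X_Inc]|upd_solve|lia].
- exists (fun m => 10 * m + 3); first by pb.
  move=> r m x w s hr [h1 h2 h3 h4 h5].
  have := h1 r (leqnn _); have := h1 r.+1 (leqnSn _) => e1 e2.
  apply: exec_eq.
  + apply: X_Seq; first by apply: exec_scan; [lia|exact: h2].
    by apply: X_Seq; [apply: exec_unwind; lia|apply: exec_move; lia].
  + by upd_solve.
  + by upd_case.
- have [u Pu Hu] := teval_bound a; have [u' Pu' Hu'] := teval_bound b.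
  (* The second term runs while the value of the first, at most [u m], is already stored, hence the
     argument [m + u m]. *)
  exists (fun m => f m + g (m + u m) + 3 * u' m + 1).
    by pb; apply: pbounded_comp => //; pb.
  move=> r m x w s hr R; have [h1 h2 h3 h4 h5] := R.
  have := h1 r (leqnn _); have := h1 r.+1 (leqnSn _) => e1 e2.
  have Va := Hu _ (fun v => s v.+2) _ h5 (fun v => h4 _).
  have Vb := Hu' _ (fun v => s v.+2) _ h5 (fun v => h4 _).
  have := @Hg r.+1 (m + u m) x w (upd s r (teval (size x) (fun v => s v.+2) a)).
  rewrite (@teval_ext _ (fun v => upd _ _ _ v.+2) (fun v => s v.+2)); last by move=> v hv; upd_case.
  move=> Hg'.
  apply: exec_eq.
  + apply: X_Seq; first by apply: Hf; [lia|exact: R].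
    apply: X_Seq; last by apply: exec_move; lia.
    by apply: Hg'; [lia|apply: ready_upd R _ _ _; lia].
  + by upd_solve.
  + by upd_case.
have [u Pu Hu] := teval_bound a; have [u' Pu' Hu'] := teval_bound b.
exists (fun m => f m + g (m + u m) + u m * (7 * u' m + 4) + 1 + 2 * u' m + 1).
  by pb; apply: pbounded_comp => //; pb.
move=> r m x w s hr R; have [h1 h2 h3 h4 h5] := R.
have := h1 r (leqnn _); have := h1 r.+1 (leqnSn _) => e1 e2.
have := h1 r.+2 ; have := h1 r.+3 => e3 e4.
have {}e3 : s r.+3 = 0 by apply: h1; lia.
have {}e4 : s r.+2 = 0 by apply: h1; lia.
have := Hu _ (fun v => s v.+2) _ h5 (fun v => h4 _).
have := Hu' _ (fun v => s v.+2) _ h5 (fun v => h4 _).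
have := @Hg r.+2 (m + u m) x w (upd s r.+1 (teval (size x) (fun v => s v.+2) a)).
rewrite (@teval_ext _ (fun v => upd _ _ _ v.+2) (fun v => s v.+2)); last by move=> v hv; upd_case.
have := @Hf r.+1 m x w s.
set va := teval _ _ a; set vb := teval _ _ b => Hf' Hg' Vb Va.
have R' : ready r.+1 m x s by apply: ready_le R _ _.
pose I k := upd (upd (upd s r.+1 (va - k)) r.+2 vb) r (k * vb).
have L : exec x w (While (CNZ r.+1) (Seq (Dec r.+1)
                (Seq (move_cnt2 r.+2 r r.+3) (move_cnt r.+3 r.+2)))) (I 0) (I va)
  (va * (7 * vb + 4) + 1).
  have -> : 7 * vb + 4 = (7 * vb + 3).+1 by lia.
  apply: exec_loop => [k|| k hk]; rewrite /I /=; [by upd_case|by upd_case|].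
  apply: exec_eq.
  + apply: X_Seq; first exact: X_Dec.
    by apply: X_Seq; [apply: exec_move2; lia|apply: exec_move; lia].
  + by upd_solve.
  + by upd_case.
have I0 : I 0 = upd (upd s r.+1 va) r.+2 vb by apply: funext; rewrite /I; upd_solve.
rewrite I0 in L.
apply: exec_eq.
- apply: X_Seq; first by apply: Hf'; [lia|exact: R'].
  apply: X_Seq; first by apply: Hg'; [lia|apply: ready_upd R' _ _ _; lia].
  apply: X_Seq; last exact: exec_clear.
  exact: L.
- by rewrite /I; upd_solve.
- rewrite /I; upd_case; nia.
Qed.

Lemma upd_same s v k : upd s v k v = k.
Proof. by rewrite /upd eqxx. Qed.

(** A truth value is 0 or 1 in register [r]. Decrementing a register that holds 0 serves as the
    empty branch. Comparison decrements both values together and asks whether the second outlives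
    the first. The quantifier parks the old value of its variable in [r + 2] during the search. *)
Fixpoint fprog (f : fml) (r : nat) : prog :=
  match f with
  | FLt a b =>
      Seq (tprog a r.+1) (Seq (tprog b r.+2)
        (Seq (While (CNZ r.+1) (Seq (Dec r.+1) (Dec r.+2)))
          (Seq (If (CNZ r.+2) (Inc r) (Dec r)) (clear r.+2))))
  | FBit b t =>
      Seq (tprog t r.+1) (Seq (move_cnt2 r.+1 r.+2 b)
        (Seq (If (CTrue b) (Inc r) (Dec r))
          (Seq (unwind r.+2 r.+1 b) (clear r.+1))))
  | FNot g => Seq (fprog g r.+1) (If (CNZ r.+1) (Dec r.+1) (Inc r))
  | FAnd g h => Seq (fprog g r) (If (CNZ r) (Seq (Dec r) (fprog h r)) (Dec r))
  | FEx v t g =>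
      Seq (tprog t r.+1) (Seq (move_cnt v.+2 r.+2)
        (Seq (While (CNZ r.+1)
               (Seq (Dec r.+1) (Seq (fprog g r.+3)
                 (Seq (If (CNZ r.+3) (Seq (Dec r.+3) (Seq (clear r) (Inc r))) (Dec r.+3))
                    (Inc v.+2)))))
          (Seq (clear v.+2) (move_cnt r.+2 v.+2))))
  end.

Lemma exec_if x w c p q s s1 s2 t :
  (holds x w c s -> exec x w p s s1 t) -> (~~ holds x w c s -> exec x w q s s2 t) ->
  exec x w (If c p q) s (if holds x w c s then s1 else s2) t.+1.
Proof. by move=> H1 H2; case: ifP => h; [exact: X_IfT (H1 _)|apply: X_IfF (negbT h) (H2 (negbT h))]. Qed.

Lemma exec_fprog f : exists2 c, pbounded c & forall r m x w s,
  fbound f + 2 <= r -> ready r m x s ->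
  exec x w (fprog f r) s
    (upd s r (feval x (fun i => nth false w i) (fun v => s v.+2) f)) (c m).
Proof.
elim: f => /= [a b|b t|g [c Pc Hc]|g [c Pc Hc] h [d Pd Hd]|v t g [c Pc Hc]].
- have [f Pf Hf] := exec_tprog a; have [g Pg Hg] := exec_tprog b.
  have [u Pu Hu] := teval_bound a; have [u' Pu' Hu'] := teval_bound b.
  exists (fun m => f m + g (m + u m) + u m * 3 + 1 + 2 + 2 * u' m + 1).
    by pb; apply: pbounded_comp => //; pb.
  move=> r m x w s hr R; have [h1 h2 h3 h4 h5] := R.
  have e1 := h1 r (leqnn _); have e2 := h1 r.+1 (leqnSn _).
  have e3 : s r.+2 = 0 by apply: h1; lia.
  have := Hu _ (fun v => s v.+2) _ h5 (fun v => h4 _).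
  have := Hu' _ (fun v => s v.+2) _ h5 (fun v => h4 _).
  have := @Hg r.+2 (m + u m) x w (upd s r.+1 (teval (size x) (fun v => s v.+2) a)).
  rewrite (@teval_ext _ (fun v => upd _ _ _ v.+2) (fun v => s v.+2)); last by move=> v hv; upd_case.
  have := @Hf r.+1 m x w s.
  set va := teval _ _ a; set vb := teval _ _ b => Hf' Hg' Vb Va.
  have R' : ready r.+1 m x s by apply: ready_le R _ _.
  pose I k := upd (upd s r.+1 (va - k)) r.+2 (vb - k).
  have L : exec x w (While (CNZ r.+1) (Seq (Dec r.+1) (Dec r.+2))) (I 0) (I va) (va * 3 + 1).
    apply: exec_loop => [k|| k hk]; rewrite /I /=; [by upd_case|by upd_case|].
    by apply: exec_eq; [apply: X_Seq; exact: X_Dec|upd_solve|].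
  have I0 : I 0 = upd (upd s r.+1 va) r.+2 vb by apply: funext; rewrite /I; upd_solve.
  rewrite I0 in L.
  apply: exec_eq.
  + apply: X_Seq; first by apply: Hf'; [lia|exact: R'].
    apply: X_Seq; first by apply: Hg'; [lia|apply: ready_upd R' _ _ _; lia].
    apply: X_Seq; first exact: L.
    apply: X_Seq; last exact: exec_clear.
    apply: exec_if => _; [exact: X_Inc|exact: X_Dec].
  + rewrite /I /=; have -> : upd (upd s r.+1 (va - va)) r.+2 (vb - va) r.+2 = vb - va by upd_case.
    by rewrite -lt0n subn_gt0; case: ltnP => _; upd_solve.
  + by rewrite /I /=; case: ifP; upd_case.
- have [f Pf Hf] := exec_tprog t.
  have [u Pu Hu] := teval_bound t.
  exists (fun m => f m + (4 * u m + 1) + 2 + (4 * u m + 1) + (2 * u m + 1)); first by pb.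
  move=> r m x w s hr R; have [h1 h2 h3 h4 h5] := R.
  have e1 := h1 r (leqnn _); have e2 := h1 r.+1 (leqnSn _).
  have e3 : s r.+2 = 0 by apply: h1; lia.
  have := Hu _ (fun v => s v.+2) _ h5 (fun v => h4 _).
  have := @Hf r.+1 m x w s.
  set va := teval _ _ t => Hf' Va.
  have R' : ready r.+1 m x s by apply: ready_le R _ _.
  have hb : b < 2 by case: b.
  have eb : s b = 0 by case: b {hb}.
  apply: exec_eq.
  + apply: X_Seq; first by apply: Hf'; [lia|exact: R'].
    apply: X_Seq; first by apply: exec_move2; lia.
    apply: X_Seq; first by apply: exec_if => _; [exact: X_Inc|exact: X_Dec].
    apply: X_Seq; first by apply: exec_unwind; lia.
    exact: exec_clear.
  + have -> : upd s r.+1 va b + upd s r.+1 va r.+1 = va by upd_case.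
    have -> : upd s r.+1 va r.+2 + upd s r.+1 va r.+1 = va by upd_case.
    rewrite /= !upd_same.
    have -> : nth false (input x w b) va = (if b then nth false w va else nth false x va)
      by case: (b).
    by case: (if b then _ else _); upd_solve.
  + by case: ifP => _; upd_case.
- exists (fun m => c m + 2); first by pb.
  move=> r m x w s hr R; have [h1 h2 h3 h4 h5] := R.
  have e1 := h1 r (leqnn _); have e2 := h1 r.+1 (leqnSn _).
  have R' : ready r.+1 m x s by apply: ready_le R _ _.
  have := @Hc r.+1 m x w s; set va := feval _ _ _ g => Hc'.
  apply: exec_eq.
  + apply: X_Seq; first by apply: Hc'; [lia|exact: R'].
    by apply: exec_if => _; [exact: X_Dec|exact: X_Inc].
  + rewrite /= !upd_same; by case: (va); upd_solve.
  + by [].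
- exists (fun m => c m + (1 + d m).+1).
    by pb; apply: (pbounded_le (g := fun m => 2 + d m)) => [|m]; [pb|lia].
  move=> r m x w s hr R; have [h1 h2 h3 h4 h5] := R.
  have e1 := h1 r (leqnn _).
  have := @Hc r m x w s; set va := feval _ _ _ g => Hc'.
  have := @Hd r m x w s; set vb := feval _ _ _ h => Hd'.
  apply: exec_eq.
  + apply: X_Seq; first by apply: Hc'; [lia|exact: R].
    apply: exec_if => hh.
      apply: X_Seq; first exact: X_Dec.
      have -> : upd (upd s r va) r (upd s r va r).-1 = s.
        by apply: funext; case: va {Hc' hh}; upd_solve.
      by apply: Hd'; [lia|exact: R].
    by apply: X_weak; [exact: X_Dec|lia].
  + rewrite /= !upd_same; by case: (va); upd_solve.
  + by [].
have [f Pf Hf] := exec_tprog t; have [u Pu Hu] := teval_bound t.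
exists (fun m => f m + (3 * m + 1) + (u m * (c (m + u m + 2) + 9) + 1) + (2 * u m + 1) + (3 * m + 1)).
  by pb; apply: pbounded_comp => //; pb.
move=> r m x w s hr R; have [h1 h2 h3 h4 h5] := R.
have e1 := h1 r (leqnn _); have e2 := h1 r.+1 (leqnSn _).
have e3 : s r.+2 = 0 by apply: h1; lia.
have e4 : s r.+3 = 0 by apply: h1; lia.
have := Hu _ (fun v => s v.+2) _ h5 (fun v => h4 _).
have := @Hf r.+1 m x w s.
set va := teval _ _ t => Hf' Va.
have R' : ready r.+1 m x s by apply: ready_le R _ _.
pose F k := feval x (fun i => nth false w i) (upd (fun u => s u.+2) v k) g.
(* State after [k] rounds: [k] is the next value to try, and [r] holds the disjunction over the
   values already tried. *)
pose I k := upd (upd (upd (upd s r.+1 (va - k)) r.+2 (s v.+2)) v.+2 k) r (has F (iota 0 k)).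
have vr : v.+2 < r by lia.
have L : exec x w (While (CNZ r.+1)
               (Seq (Dec r.+1) (Seq (fprog g r.+3)
                 (Seq (If (CNZ r.+3) (Seq (Dec r.+3) (Seq (clear r) (Inc r))) (Dec r.+3))
                    (Inc v.+2))))) (I 0) (I va) (va * (c (m + u m + 2) + 9) + 1).
  have -> : c (m + u m + 2) + 9 = (1 + (c (m + u m + 2) + (6 + 1))).+1 by lia.
  apply: exec_loop => [k|| k hk]; rewrite /I; [rewrite /=; upd_case|rewrite /=; upd_case|].
  set s0 := upd _ r _.
  have E : feval x (fun i => nth false w i) (fun u => upd s0 r.+1 (s0 r.+1).-1 u.+2) g = F k.
    by apply: feval_ext => y hy; rewrite /s0; upd_case.
  have R1 : ready r.+3 (m + u m + 2) x (upd s0 r.+1 (s0 r.+1).-1).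
    split=> [y hy||| y|]; last by lia.
    - have := h1 y; rewrite /s0; upd_case.
    - by rewrite /s0; upd_case.
    - by rewrite /s0; upd_case.
    - have := h4 y; have := h4 v.+2; have := leq_b1 (has F (iota 0 k)); rewrite /s0; upd_case.
  have := @Hc r.+3 _ x w _ _ R1; rewrite E => Hc'.
  apply: exec_eq.
  + apply: X_Seq; first exact: X_Dec.
    apply: X_Seq; first by apply: Hc'; lia.
    apply: X_Seq; [apply: exec_if => hh|exact: X_Inc]; last by apply: (@X_weak _ _ _ _ _ 1 5) => //; exact: X_Dec.
    apply: (@X_weak _ _ _ _ _ (1 + (3 + 1))) => //.
    apply: X_Seq; first exact: X_Dec.
    apply: X_Seq; [apply: X_weak; first exact: exec_clear|exact: X_Inc].
    by have := leq_b1 (has F (iota 0 k)); rewrite /s0; upd_case.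
  + have -> : has F (iota 0 k.+1) = has F (iota 0 k) || F k.
      by rewrite -addn1 iotaD has_cat /= add0n orbF.
    rewrite /holds !upd_same.
    rewrite /s0; case: (F k); case: (has F _); upd_solve.
  + by lia.
have I0 : I 0 = upd (upd (upd s r.+1 va) v.+2 0) r.+2 (s v.+2).
  by apply: funext; rewrite /I; upd_solve.
rewrite I0 in L.
have hv := h4 v.+2.
apply: exec_eq.
- apply: X_Seq; first by apply: Hf'; [lia|exact: R'].
  apply: X_Seq.
    apply: exec_eq; first by apply: exec_move; lia.
    - by move=> y; instantiate (1 := upd (upd (upd s r.+1 va) v.+2 0) r.+2 (s v.+2)); upd_case.
    - exact: leqnn.
  apply: X_Seq; first exact: L.
  apply: X_Seq; first exact: exec_clear.
  by apply: exec_move; lia.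
- by rewrite /I; upd_solve.
- have hh : va * (c (m + u m + 2) + 9) <= u m * (c (m + u m + 2) + 9) by rewrite leq_mul2r Va orbT.
  by rewrite /I; upd_case.
Qed.

(** * From counter programs to Turing machines *)

Inductive instr := IInc of nat & nat | IDec of nat & nat | IBr of test & nat & nat.

Fixpoint plen (p : prog) : nat :=
  match p with
  | Inc _ | Dec _ => 1
  | Seq p q => plen p + plen q
  | If _ p q => (plen p + plen q).+1
  | While _ p => (plen p).+1
  end.

(** [s] is the address of the first instruction and [e] the address where control goes afterwards; a
    loop body returns to the test at [s]. *)
Fixpoint code (p : prog) (s e : nat) : seq instr :=
  match p with
  | Inc v => [:: IInc v e]
  | Dec v => [:: IDec v e]
  | Seq p q => code p s (s + plen p) ++ code q (s + plen p) e
  | If c p q =>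
      IBr c s.+1 (s.+1 + plen p) :: code p s.+1 e ++ code q (s.+1 + plen p) e
  | While c p => IBr c s.+1 e :: code p s.+1 s
  end.

Lemma size_code p s e : size (code p s e) = plen p.
Proof.
by elim: p s e => //= [p IHp q IHq|c p IHp q IHq|c p IHp] s e;
  rewrite ?size_cat ?IHp ?IHq.
Qed.

Definition test_ok (K : nat) (c : test) : bool :=
  if c is CNZ v then 2 <= v < K.+2 else true.

(** With [K] work tapes the registers are 0 to [K + 1]: two heads, then one tape per counter. *)
Fixpoint prog_ok (K : nat) (p : prog) : bool :=
  match p with
  | Inc v | Dec v => v < K.+2
  | Seq p q => prog_ok K p && prog_ok K q
  | If c p q => [&& test_ok K c, prog_ok K p & prog_ok K q]
  | While c p => test_ok K c && prog_ok K p
  end.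

Definition test_syms (c : test) (ins wk : seq Sym) : bool :=
  match c with
  | CNZ v => nth None wk (v - 2) != Some true
  | CSome b => nth None ins b != None
  | CTrue b => nth None ins b == Some true
  end.

(** The left-hand side of a rule, namely the state and all scanned symbols. One rule per key leaves
    neither a choice nor a gap. *)
Definition key : Type := nat * seq Sym * seq Sym.

(* State 0 writes the origin markers, state [q >= 3] executes instruction [q - 3]. *)
Definition mkrule (K : nat) (cd : seq instr) (k : key) : rule :=
  let: (q, ins, wk) := k in
  let still n := nseq n DStay in
  if q == 0 then Rule q ins wk 3 (still 2) (nseq K (Some true)) (still K) else
  match nth (IInc 0 0) cd (q - 3) with
  | IInc v e =>
      Rule q ins wk e (mkseq (fun i => if i == v then DRight else DStay) 2)
        wk (mkseq (fun i => if i.+2 == v then DRight else DStay) K)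
  | IDec v e =>
      Rule q ins wk e (mkseq (fun i => if i == v then DLeft else DStay) 2)
        wk (mkseq (fun i => if (i.+2 == v) && (nth None wk i != Some true)
                            then DLeft else DStay) K)
  | IBr c a b =>
      Rule q ins wk (if test_syms c ins wk then a else b) (still 2) wk (still K)
  end.

Definition sym_vecs (n : nat) : seq (seq Sym) := [seq val t | t : n.-tuple (option bool)].

Definition keys (K m : nat) : seq key :=
  [seq (qi, wk) | qi <- [seq (q, ins) | q <- 0 :: iota 3 m, ins <- sym_vecs 2],
                  wk <- sym_vecs K].

Definition machine (K : nat) (cd : seq instr) : TM :=
  MkTM K (map (mkrule K cd) (keys K (size cd))).

Lemma mem_sym_vecs n v : size v = n -> v \in sym_vecs n.
Proof.
by move=> /eqP H; apply/mapP; exists (Tuple H : n.-tuple (option bool)); rewrite ?mem_enum.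
Qed.

Lemma sym_vecs_size n v : v \in sym_vecs n -> size v = n.
Proof. by case/mapP => t _ ->; rewrite size_tuple. Qed.

Lemma ohead_filter_pred1 (T : eqType) (s : seq T) a :
  a \in s -> ohead [seq b <- s | b == a] = Some a.
Proof.
elim: s => //= b s IH; rewrite inE eq_sym; case: eqP => [-> //|_] /= h; exact: IH.
Qed.

Lemma rule_matches_mkrule K cd xs C q ins wk :
  size ins = 2 -> size wk = K -> size [seq read_input xp.1 xp.2 | xp <- zip xs (c_ipos C)] = 2 ->
  size (map t_cur (c_work C)) = K ->
  rule_matches xs C (mkrule K cd (q, ins, wk)) =
  ((q, ins, wk) == (c_q C, [seq read_input xp.1 xp.2 | xp <- zip xs (c_ipos C)],
                    map t_cur (c_work C)) :> key).
Proof.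
move=> h1 h2 h3 h4; rewrite /rule_matches /mkrule !xpair_eqE h3 h4.
case: ifP => [|_]; first by rewrite /= !size_nseq !eqxx !andbT andbA.
by case: (nth _ _ _) => [v e|v e|c a b] /=; rewrite ?size_mkseq ?size_nseq ?h2 !eqxx !andbT andbA.
Qed.

(** A counter is the distance of the head from a [Some true] marker at the origin of an otherwise
    blank tape; the zero test reads the marker. The blanks on the right are cells visited
    earlier. *)
Definition counter_tape (v : nat) (t : tape) : Prop :=
  exists r, t_right t = nseq r None /\
    match v with
    | 0 => t_left t = [::] /\ t_cur t = Some true
    | v'.+1 => t_left t = rcons (nseq v' None) (Some true) /\ t_cur t = None
    end.

Lemma counter_tape_cur v t : counter_tape v t -> (t_cur t != Some true) = (v != 0).
Proof. by case=> r [_]; case: v => [|v] [_ ->]. Qed.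

Lemma counter_tape_inc v t : counter_tape v t ->
  counter_tape v.+1 (write_move (t_cur t) DRight t).
Proof.
case=> r [hr hv]; rewrite /write_move hr /counter_tape.
case: r {hr} => [|r] /=.
  by exists 0; split => //; case: v hv => [|v] [-> ->].
by exists r; split => //; case: v hv => [|v] [-> ->].
Qed.

Lemma counter_tape_dec v t : counter_tape v.+1 t ->
  counter_tape v (write_move (t_cur t) DLeft t).
Proof.
case=> r [hr [hl hc]]; rewrite /write_move hl hc hr /counter_tape.
by case: v {hl} => [|v] /=; exists r.+1.
Qed.

Lemma write_move_stay t : write_move (t_cur t) DStay t = t.
Proof. by case: t. Qed.

Definition represents (K q : nat) (s : nat -> nat) (C : cfg) : Prop :=
  [/\ c_q C = q, c_ipos C = [:: s 0; s 1], size (c_work C) = K &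
      forall i, i < K -> counter_tape (s i.+2) (nth blank_tape (c_work C) i)].

Definition in_syms (x w : seq bool) (s : nat -> nat) := [:: read_input x (s 0); read_input w (s 1)].

Lemma step_machine K cd x w q s C :
  c_q C = q -> c_ipos C = [:: s 0; s 1] -> size (c_work C) = K ->
  q \in 0 :: iota 3 (size cd) ->
  let r := mkrule K cd (q, in_syms x w s, map t_cur (c_work C)) in
  step (machine K cd) [:: x; w] C =
  Cfg (r_q' r) [seq move_pos dp.1 dp.2 | dp <- zip (r_inmv r) [:: s 0; s 1]]
      [seq write_move sdt.1.1 sdt.1.2 sdt.2
         | sdt <- zip (zip (r_write r) (r_workmv r)) (c_work C)].
Proof.
move=> hq hi hw hin r; rewrite /step hq.
have -> : (q == q_acc) || (q == q_rej) = false.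
  by move: hin; rewrite inE mem_iota /q_acc /q_rej; case: q {hq r} => [|[|[|q]]].
have hs : [seq read_input xp.1 xp.2 | xp <- zip [:: x; w] (c_ipos C)] = in_syms x w s by rewrite hi.
rewrite /= filter_map.
set P := preim _ _.
have -> : [seq k <- keys K (size cd) | P k] =
          [seq k <- keys K (size cd) | k == (q, in_syms x w s, map t_cur (c_work C))].
  apply: eq_in_filter => -[[q0 i0] w0] /allpairsP [[[q1 i1] w1] [h1 h2 [-> -> ->]]].
  rewrite [_.1]/= in h1; rewrite [_.2]/= in h2.
  case/allpairsP: h1 => [[q2 i2] [_ h3 [_ ->]]].
  by rewrite /P /= rule_matches_mkrule ?hs ?hq ?size_map // ?(sym_vecs_size h3) ?(sym_vecs_size h2).
have hk : (q, in_syms x w s, map t_cur (c_work C)) \in keys K (size cd).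
  rewrite /keys; apply/allpairsP; exists ((q, in_syms x w s), map t_cur (c_work C)); split => //.
  - apply/allpairsP; exists (q, in_syms x w s); split => //; exact: mem_sym_vecs.
  - by apply: mem_sym_vecs; rewrite size_map.
have := ohead_filter_pred1 hk; case: [seq k <- _ | _] => // k l /= [->].
by rewrite hi.
Qed.

Definition istep (x w : seq bool) (i : instr) (s : nat -> nat) : nat * (nat -> nat) :=
  match i with
  | IInc v e => (e, upd s v (s v).+1)
  | IDec v e => (e, upd s v (s v).-1)
  | IBr c a b => (if holds x w c s then a else b, s)
  end.

Definition instr_ok (K : nat) (i : instr) : bool :=
  match i with
  | IInc v _ | IDec v _ => v < K.+2
  | IBr c _ _ => test_ok K c
  end.

Lemma nth_write_moves (ts : seq tape) (mv : seq Dir) i :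
  i < size ts -> size mv = size ts ->
  nth blank_tape [seq write_move sdt.1.1 sdt.1.2 sdt.2
                    | sdt <- zip (zip (map t_cur ts) mv) ts] i =
  write_move (t_cur (nth blank_tape ts i)) (nth DStay mv i) (nth blank_tape ts i).
Proof.
move=> hi hm; rewrite (nth_map (None, DStay, blank_tape)).
  rewrite nth_zip /=; last by rewrite size_zip size_map hm minnn.
  by rewrite nth_zip /= ?size_map // (nth_map blank_tape).
by rewrite !size_zip size_map hm !minnn.
Qed.

Lemma size_write_moves (ts : seq tape) (mv : seq Dir) :
  size mv = size ts ->
  size [seq write_move sdt.1.1 sdt.1.2 sdt.2
          | sdt <- zip (zip (map t_cur ts) mv) ts] = size ts.
Proof. by move=> hm; rewrite size_map !size_zip size_map hm !minnn. Qed.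

Lemma represents_istep K cd x w q s C :
  represents K q s C -> 3 <= q < 3 + size cd ->
  instr_ok K (nth (IInc 0 0) cd (q - 3)) ->
  let: (q', s') := istep x w (nth (IInc 0 0) cd (q - 3)) s in
  represents K q' s' (step (machine K cd) [:: x; w] C).
Proof.
case=> [cq ci cw ct] hq ok.
rewrite (step_machine (cd := cd) x w cq ci cw); last by rewrite inE mem_iota hq orbT.
rewrite /mkrule.
have -> : q == 0 = false by case: (q) hq.
case: (nth _ _ _) ok => [v e|v e|c q1 q2] /= ok.
- split => //=.
  + rewrite /upd; case: v ok => [|[|v]] //= _.
  + by rewrite size_write_moves // size_mkseq.
  + move=> i hi; rewrite nth_write_moves ?cw ?size_mkseq // nth_mkseq //= /upd.
    case: (i.+2 =P v) => [<-|_]; first exact: counter_tape_inc (ct _ hi).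
    by have := ct _ hi; case: nth.
- split => //=.
  + rewrite /upd; case: v ok => [|[|v]] //= _.
  + by rewrite size_write_moves // size_mkseq.
  + move=> i hi; rewrite nth_write_moves ?cw ?size_mkseq // nth_mkseq //= /upd.
    rewrite (nth_map blank_tape) ?cw // (counter_tape_cur (ct _ hi)).
    case: (i.+2 =P v) => [<-|_] /=; last by have := ct _ hi; case: nth.
    (* At zero the machine must not move left off the marker; the scanned symbol tells it so, in
       accordance with the truncated predecessor. *)
    case: eqP => [e0|] /=; first by rewrite e0 /= -{1}e0; have := ct _ hi; case: nth.
    by case E: (s i.+2) (ct _ hi) => [|k] //= hk _; apply: counter_tape_dec.
- split => //=.
  + have -> // : test_syms c (in_syms x w s) (map t_cur (c_work C)) = holds x w c s.
    case: c ok => [v|b|b] /= ok.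
    * rewrite (nth_map blank_tape) ?cw; last by lia.
      by rewrite (@counter_tape_cur (s v)) //; have := ct (v - 2); rewrite -[in s _]addn2 subnK; [apply|]; lia.
    * have E (z : seq bool) k : (read_input z k != None) = (k < size z).
        rewrite /read_input; case: (ltnP k (size z)) => h; first by rewrite (nth_map false).
        by rewrite nth_default ?size_map.
      by case: b {ok} => /=; rewrite E.
    * have E (z : seq bool) k : (read_input z k == Some true) = nth false z k.
        rewrite /read_input; case: (ltnP k (size z)) => h; last by rewrite !nth_default ?size_map.
        by rewrite (nth_map false) //; case: nth.
      by case: b {ok} => /=; rewrite E.
  + by rewrite size_write_moves // size_nseq.
  + move=> i hi; rewrite nth_write_moves ?cw ?size_nseq // nth_nseq hi write_move_stay; exact: ct.
Qed.

(** Addresses are machine states. States 0, 1 and 2 are initial, accepting and rejecting, hence the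
    shift by 3. *)
Definition code_at (cd : seq instr) (s : nat) (l : seq instr) : Prop :=
  [/\ 3 <= s, s + size l <= 3 + size cd &
      forall i, i < size l -> nth (IInc 0 0) cd (s + i - 3) = nth (IInc 0 0) l i].

Lemma code_at_cat cd s l1 l2 : code_at cd s (l1 ++ l2) ->
  code_at cd s l1 /\ code_at cd (s + size l1) l2.
Proof.
case=> h1 h2 h3; rewrite size_cat in h2 h3; split; split => //; try by lia.
- by move=> i hi; rewrite h3 ?nth_cat ?hi //; lia.
- move=> i hi; rewrite -addnA h3 ?nth_cat; last by lia.
  by case: ltnP => h; [lia|rewrite addKn].
Qed.

Lemma code_at_cons cd s a l : code_at cd s (a :: l) ->
  [/\ 3 <= s < 3 + size cd, nth (IInc 0 0) cd (s - 3) = a & code_at cd s.+1 l].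
Proof.
move=> H; have [[h1 h2 h3] h4] := @code_at_cat cd s [:: a] l H; split.
- by move: h2 => /=; lia.
- by have := h3 0 isT; rewrite addn0.
- by rewrite addn1 in h4.
Qed.

(** The induction follows the execution, not the program, since a loop re-enters its own code at the
    same address. *)
Lemma represents_exec K cd x w p s s' t : exec x w p s s' t -> prog_ok K p ->
  forall q e, code_at cd q (code p q e) -> exists2 k, k <= t &
  forall C, represents K q s C ->
    represents K e s' (iter k (step (machine K cd) [:: x; w]) C).
Proof.
elim=> {p s s' t}.
- move=> v s /= ok q e /code_at_cons [h1 h2 _]; exists 1 => // C R.
  by have := @represents_istep K cd x w q s C R h1; rewrite h2; apply.
- move=> v s /= ok q e /code_at_cons [h1 h2 _]; exists 1 => // C R.
  by have := @represents_istep K cd x w q s C R h1; rewrite h2; apply.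
- move=> p q s1 s2 s3 t t' _ IH1 _ IH2 /= /andP [ok1 ok2] a e /code_at_cat [].
  rewrite size_code => h1 h2.
  have [k1 l1 H1] := IH1 ok1 _ _ h1; have [k2 l2 H2] := IH2 ok2 _ _ h2.
  exists (k2 + k1); first by lia.
  by move=> C R; rewrite iterD; apply: H2; apply: H1.
- move=> c p q s s' t hc _ IH /= /and3P [ok1 ok2 ok3] a e /code_at_cons [h1 h2].
  case/code_at_cat => h3 _; have [k lk H] := IH ok2 _ _ h3; exists (k + 1); first by lia.
  move=> C R; rewrite iterD; apply: H.
  by have := @represents_istep K cd x w a s C R h1; rewrite h2 /= hc; apply.
- move=> c p q s s' t hc _ IH /= /and3P [ok1 ok2 ok3] a e /code_at_cons [h1 h2].
  case/code_at_cat => _; rewrite size_code => h3; have [k lk H] := IH ok3 _ _ h3.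
  exists (k + 1); first by lia.
  move=> C R; rewrite iterD; apply: H.
  by have := @represents_istep K cd x w a s C R h1; rewrite h2 /= (negbTE hc); apply.
- move=> c p s1 s2 s3 t t' hc _ IH1 _ IH2 ok a e ca; have /andP [ok1 ok2] := ok.
  have [h1 h2 h3] := code_at_cons ca.
  have [k1 l1 H1] := IH1 ok2 _ _ h3; have [k2 l2 H2] := IH2 ok _ _ ca.
  exists (k2 + (k1 + 1)); first by lia.
  move=> C R; rewrite !iterD; apply: H2; apply: H1.
  by have := @represents_istep K cd x w a s1 C R h1; rewrite h2 /= hc; apply.
- move=> c p s hc /= /andP [ok1 ok2] a e /code_at_cons [h1 h2 _]; exists 1 => // C R.
  by have := @represents_istep K cd x w a s C R h1; rewrite h2 /= (negbTE hc); apply.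
- move=> p s s' t t' _ IH le ok q e h; have [k lk H] := IH ok q e h.
  by exists k => //; exact: leq_trans lk le.
Qed.

Lemma tprog_ok t r : 2 <= r -> exists K0, forall K, K0 <= K -> prog_ok K (tprog t r).
Proof.
elim: t r => [v|k||a IHa b IHb|a IHa b IHb] r hr /=.
- by exists (v + r) => K hK; lia.
- exists r => K hK; elim: k => [|k IH] /=; first by lia.
  by rewrite IH; lia.
- by exists r => K hK; lia.
- have [K1 H1] := IHa r hr; have [|K2 H2] := IHb r.+1; first by lia.
  exists (K1 + K2 + r) => K hK; rewrite H1 ?H2; lia.
- have [|K1 H1] := IHa r.+1; first by lia.
  have [|K2 H2] := IHb r.+2; first by lia.
  exists (K1 + K2 + r + 3) => K hK; rewrite H1 ?H2; lia.
Qed.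

Lemma fprog_ok f r : 2 <= r -> exists K0, forall K, K0 <= K -> prog_ok K (fprog f r).
Proof.
elim: f r => [a b|b t|g IH|g IHg h IHh|v t g IH] r hr /=.
- have [|K1 H1] := @tprog_ok a r.+1; first by lia.
  have [|K2 H2] := @tprog_ok b r.+2; first by lia.
  exists (K1 + K2 + r + 3) => K hK; rewrite H1 ?H2; lia.
- have [|K1 H1] := @tprog_ok t r.+1; first by lia.
  exists (K1 + r + 3) => K hK; rewrite H1; case: b; lia.
- have [|K1 H1] := IH r.+1; first by lia.
  exists (K1 + r + 3) => K hK; rewrite H1; lia.
- have [K1 H1] := IHg r hr; have [K2 H2] := IHh r hr.
  exists (K1 + K2 + r + 3) => K hK; rewrite H1 ?H2; lia.
- have [|K1 H1] := @tprog_ok t r.+1; first by lia.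
  have [|K2 H2] := IH r.+3; first by lia.
  exists (K1 + K2 + r + v + 3) => K hK; rewrite H1 ?H2; lia.
Qed.

Lemma outcome_stable M xs t t' b :
  outcome M xs t = Some b -> t <= t' -> outcome M xs t' = Some b.
Proof.
move=> H /subnK <-; elim: (t' - t) => // k IH; move: IH.
rewrite /outcome addSn /run /= -/(run M xs _); set C := run M xs (k + t).
rewrite /step; case: (c_q C =P q_acc) => [-> //|h1]; case: (c_q C =P q_rej) => [-> //|h2].
by [].
Qed.

Lemma outcome_unique M xs t t' b b' :
  outcome M xs t = Some b -> outcome M xs t' = Some b' -> b = b'.
Proof.
move=> H H'; case: (leqP t t') => h; last move/ltnW: h => h.
  by have := outcome_stable H h; rewrite H' => -[].
by have := outcome_stable H' h; rewrite H => -[].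
Qed.

Lemma fml_machine f : exists V, exists2 T, pbounded T &
  forall x w : seq bool, exists2 t, t <= T (size x + size w) &
    outcome V [:: x; w] t = Some (feval x (fun i => nth false w i) (fun=> 0) f).
Proof.
have [c Pc Hc] := exec_fprog f.
pose r := (fbound f).+2; have r2 : 1 < r by [].
have [K0 HK] := @fprog_ok f r r2.
(* Register [r] must have a tape, as the final branch tests it. *)
pose K := maxn K0 r.+1.
pose p := fprog f r; pose cd := code p 3 (3 + plen p) ++ [:: IBr (CNZ r) q_acc q_rej].
have cda : code_at cd 3 cd by split=> // i hi; congr nth; lia.
have [h1 h2] := code_at_cat cda; rewrite size_code in h2.
(* One step writes the origin markers and one takes the final branch. *)
exists (machine K cd), (fun m => c m + 2) => [|x w]; first by pb.
have R0 : ready r (size x + size w) x (fun=> 0) by split=> //; exact: leq_addr.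
have hr : fbound f + 2 <= r by rewrite addn2.
have EX := Hc r _ x w _ hr R0.
have ok : prog_ok K p by apply: HK; rewrite leq_maxl.
have [k lk H] := represents_exec EX ok h1.
exists (1 + (k + 1)); first by lia.
rewrite /outcome /run iterD iterD /=.
set C1 := step _ _ (init_cfg _ _).
have R1 : represents K 3 (fun=> 0) C1.
  set I := init_cfg _ _ in C1 *.
  have hw : size (c_work I) = K by rewrite size_nseq.
  rewrite /C1 (@step_machine K cd x w 0 (fun=> 0) I) //=.
  split=> //=; first by rewrite size_map !size_zip !size_nseq !minnn.
  move=> i hi; rewrite (nth_map (None, DStay, blank_tape)) ?size_zip ?size_nseq ?minnn //.
  by rewrite !nth_zip ?size_zip ?size_nseq ?minnn //= !nth_nseq hi; exists 0.
have R2 := H _ R1.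
have [h3 h4 _] := code_at_cons h2.
have := @represents_istep K cd x w _ _ _ R2 h3; rewrite h4.
have -> : instr_ok K (IBr (CNZ r) q_acc q_rej) by rewrite /= /K; lia.
move=> /(_ isT) /= [-> _ _ _]; rewrite upd_same.
by case: feval.
Qed.

(* Second-order existential (Fagin-style) definability: the witness is an
   infinite bit sequence, but a formula reads only polynomially many bits. *)
Definition sigma11 (A : seq bool -> Prop) : Prop :=
  exists f, forall x, A x <-> exists W, feval x W (fun=> 0) f.

Lemma sigma11_NP (L : language) : sigma11 (fun x => L x) -> NP_class L.
Proof.
case=> f Hf; have [V [T PT HV]] := fml_machine f; have [g Pg Hg] := feval_local f.
have [K [d HK]] := pbounded_NP_form (pbounded_add PT Pg).
exists V, d, K; split=> [x w|x].
  have [t lt Ht] := HV x w; exists t; rewrite Ht; split => //.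
  by rewrite Nat_powE; apply: leq_trans lt (leq_trans (leq_addr _ _) (HK _)).
rewrite Hf; split=> [[W HW]|[w [_ [t Ht]]]].
  exists (mkseq W (g (size x))); split.
    by rewrite size_mkseq Nat_powE; apply: leq_trans (leq_addl _ _) (HK _).
  have [t lt Ht] := HV x (mkseq W (g (size x))); exists t; rewrite Ht; congr Some.
  rewrite -HW; apply: (Hg _ _ _ _ (size x)) => // i hi; exact: nth_mkseq.
(* A certificate, continued by zeros, is a witness. *)
exists (nth false w); have [t' _ Ht'] := HV x w; exact: outcome_unique Ht' Ht.
Qed.

(** * Second-order definability of computations *)

(** A division-free variant of Cantor's pairing, so that it is the value of a term, [tpr]. *)
Definition pr (i j : nat) : nat := (i + j) * (i + j) + j.
Arguments pr : simpl never.

(** [j] is smaller than the distance from the square of [i + j] to the next square, so [i + j] can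
    be recovered. *)
Lemma pr_inj i j i' j' : pr i j = pr i' j' -> i = i' /\ j = j'.
Proof.
rewrite /pr => H.
have [h|[h|h]] : i + j < i' + j' \/ i' + j' < i + j \/ i + j = i' + j' by lia.
- have : (i + j).+1 * (i + j).+1 <= (i' + j') * (i' + j') by apply: leq_mul.
  lia.
- have : (i' + j').+1 * (i' + j').+1 <= (i + j) * (i + j) by apply: leq_mul.
  lia.
- by move: H; rewrite h; lia.
Qed.

(** * Derived connectives and their semantics *)

Definition tpr (a b : term) : term := TAdd (TMul (TAdd a b) (TAdd a b)) b.

Definition FOr a b := FNot (FAnd (FNot a) (FNot b)).
Definition FImp a b := FNot (FAnd a (FNot b)).
Definition FIff a b := FAnd (FImp a b) (FImp b a).
Definition FAll v t f := FNot (FEx v t (FNot f)).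
Definition FTrue := FLt (TNum 0) (TNum 1).
Definition FAnds (l : seq fml) := foldr FAnd FTrue l.
Definition FLit (b : bool) f := if b then f else FNot f.
Definition FLe a b := FLt a (TAdd b (TNum 1)).
Definition FEq a b := FAnd (FLe a b) (FLe b a).
Definition texp t k := iter k (TMul t) (TNum 1).

Section Semantics.
Context (x : seq bool) (W : nat -> bool) (e : nat -> nat).

Lemma fevalOr a b : feval x W e (FOr a b) = feval x W e a || feval x W e b.
Proof. by rewrite /= negb_and !negbK. Qed.

Lemma fevalImp a b : feval x W e (FImp a b) = (feval x W e a ==> feval x W e b).
Proof. by rewrite /= negb_and negbK implybE. Qed.

Lemma fevalIff a b : feval x W e (FIff a b) = (feval x W e a == feval x W e b).
Proof. by rewrite /= !negb_and !negbK; do 2 case: feval. Qed.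

Lemma fevalAll v t f : feval x W e (FAll v t f) =
  all (fun k => feval x W (upd e v k) f) (iota 0 (teval (size x) e t)).
Proof. by rewrite /= -all_predC; apply: eq_all => k; rewrite /= negbK. Qed.

Lemma fevalAnds l : feval x W e (FAnds l) = all (feval x W e) l.
Proof. by elim: l => //= f l <-. Qed.

Lemma fevalLit b f : feval x W e (FLit b f) = (b == feval x W e f).
Proof. by case: b => /=; case: feval. Qed.

Lemma fevalLe a b : feval x W e (FLe a b) = (teval (size x) e a <= teval (size x) e b).
Proof. by rewrite /= addn1 ltnS. Qed.

Lemma fevalEq a b : feval x W e (FEq a b) = (teval (size x) e a == teval (size x) e b).
Proof. by rewrite -[LHS]/(feval x W e (FLe a b) && feval x W e (FLe b a)) !fevalLe eqn_leq. Qed.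

Lemma fevalNot f : feval x W e (FNot f) = ~~ feval x W e f.
Proof. by []. Qed.

Lemma fevalAnd a b : feval x W e (FAnd a b) = feval x W e a && feval x W e b.
Proof. by []. Qed.

Lemma fevalEx v t f : feval x W e (FEx v t f) =
  has (fun k => feval x W (upd e v k) f) (iota 0 (teval (size x) e t)).
Proof. by []. Qed.

Lemma fevalLt a b : feval x W e (FLt a b) = (teval (size x) e a < teval (size x) e b).
Proof. by []. Qed.

Lemma fevalBit0 t : feval x W e (FBit false t) = nth false x (teval (size x) e t).
Proof. by []. Qed.

Lemma teval_texp t k : teval (size x) e (texp t k) = teval (size x) e t ^ k.
Proof. by elim: k => //= k ->; rewrite expnS. Qed.

End Semantics.

Definition fevalE := (fevalOr, fevalImp, fevalIff, fevalAll, fevalAnds, fevalLit, fevalLe,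
  fevalEq, fevalNot, fevalAnd, fevalEx, fevalLt, fevalBit0).
Arguments feval : simpl never.
Arguments FAnds : simpl never.
Arguments texp : simpl never.

Lemma all_iotaP (P : pred nat) n : reflect (forall k, k < n -> P k) (all P (iota 0 n)).
Proof.
apply: (iffP allP) => H k; first by move=> hk; apply: H; rewrite mem_iota.
by rewrite mem_iota add0n => /H.
Qed.

Lemma has_iotaP (P : pred nat) n : reflect (exists2 k, k < n & P k) (has P (iota 0 n)).
Proof.
apply: (iffP hasP) => -[k hk Pk]; exists k => //; first by move: hk; rewrite mem_iota.
by rewrite mem_iota.
Qed.

(** * Configurations as arrays of bits *)

Definition sym_bit (b : bool) (s : Sym) : bool := if b then s == Some true else s != None.

(** A symbol is stored as two bits, being non-blank and being a one, which tell the three symbols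
    apart. *)
Lemma sym_bit_inj s s' : (forall b, sym_bit b s = sym_bit b s') -> s = s'.
Proof. by move=> H; have := H true; have := H false; move: s s' {H} => [[]|] [[]|]. Qed.

(* Side 0 is the part of the tape left of the head, side 1 the part right of it,
   both read away from the head; side 2 is the scanned cell. *)
Definition sym_at (side : nat) (tp : tape) (i : nat) : Sym :=
  match side with
  | 0 => nth None (t_left tp) i
  | 1 => nth None (t_right tp) i
  | _ => t_cur tp
  end.

(** Group 0 holds the state and the input head position in one-hot form; group [j + 1] holds work
    tape [j], with [m] equal to twice the side plus the bit of the symbol code. *)
Definition field (C : cfg) (j m i : nat) : bool :=
  match j with
  | 0 => if m is 0 then c_q C == i else head 0 (c_ipos C) == i
  | j'.+1 => sym_bit (odd m) (sym_at m./2 (nth blank_tape (c_work C) j') i)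
  end.

Definition skey : Type := nat * Sym * seq Sym.

(** The choice of a rule depends only on the state and the scanned symbols; it is made here on a
    dummy configuration that shows just those symbols. *)
Definition find_rule (M : TM) (k : skey) : option rule :=
  let: (q, v, vs) := k in
  if (q == q_acc) || (q == q_rej) then None else
  ohead [seq r <- tm_rules M |
    rule_matches [:: if v is Some b then [:: b] else [::]]
      (Cfg q [:: 0] [seq Tape [::] s [::] | s <- vs]) r].

(** Without an applicable rule the scanned symbols are written back and nothing moves, so halting is
    one more action. *)
Definition action (M : TM) (k : skey) : nat * Dir * seq Sym * seq Dir :=
  let: (q, v, vs) := k in
  if find_rule M k is Some r then (r_q' r, head DStay (r_inmv r), r_write r, r_workmv r)
  else (q, DStay, vs, nseq (size vs) DStay).

Arguments action : simpl never.

Definition ckey (x : seq bool) (C : cfg) : skey :=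
  (c_q C, read_input x (head 0 (c_ipos C)), map t_cur (c_work C)).

Definition shaped (M : TM) (C : cfg) :=
  size (c_ipos C) = 1 /\ size (c_work C) = tm_nwork M.

Lemma rule_matches_ext xs xs' C C' :
  [seq read_input xp.1 xp.2 | xp <- zip xs (c_ipos C)] =
  [seq read_input xp.1 xp.2 | xp <- zip xs' (c_ipos C')] ->
  map t_cur (c_work C) = map t_cur (c_work C') -> c_q C = c_q C' ->
  rule_matches xs C =1 rule_matches xs' C'.
Proof. by rewrite /rule_matches => -> -> -> r. Qed.

Lemma ohead_filterP (T : Type) (P : pred T) (s : seq T) a :
  ohead [seq b <- s | P b] = Some a -> P a.
Proof. by elim: s => //= b s IH; case: ifP => //= h [<-]. Qed.

Lemma step_action M x C : shaped M C ->
  let: (q, d, ws, ds) := action M (ckey x C) in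
  [/\ size ws = tm_nwork M, size ds = tm_nwork M &
      step M [:: x] C = Cfg q [:: move_pos d (head 0 (c_ipos C))]
        [seq write_move sdt.1.1 sdt.1.2 sdt.2 | sdt <- zip (zip ws ds) (c_work C)]].
Proof.
case=> h1 h2; rewrite /action /find_rule /ckey /step.
have E : rule_matches [:: if read_input x (head 0 (c_ipos C)) is Some b then [:: b] else [::]]
      (Cfg (c_q C) [:: 0] [seq Tape [::] s [::] | s <- map t_cur (c_work C)])
   =1 rule_matches [:: x] C.
  apply: rule_matches_ext => //=.
  - case: (c_ipos C) h1 => [|p [|]] //= _; by case: (read_input x p).
  - by rewrite -!map_comp; apply: eq_map.
rewrite (eq_filter E).
have none : [/\ size (map t_cur (c_work C)) = tm_nwork M,
    size (nseq (size (map t_cur (c_work C))) DStay) = tm_nwork M &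
    C = Cfg (c_q C) [:: move_pos DStay (head 0 (c_ipos C))]
        [seq write_move sdt.1.1 sdt.1.2 sdt.2 | sdt <-
           zip (zip (map t_cur (c_work C)) (nseq (size (map t_cur (c_work C))) DStay)) (c_work C)]].
  rewrite size_nseq size_map; split => //.
  case: C h1 h2 {E} => q [|p [|]] //= wk _ h2; congr Cfg.
  by elim: wk {h2} => //= a wk {1}->; case: a.
case: ifP => // _.
case R : (ohead _) => [r|] //=.
have := ohead_filterP R; rewrite /rule_matches => /and5P [_ _ _ /eqP e1 /andP [/eqP e2 /eqP e3]].
rewrite e2 e3 size_map; split => //; congr Cfg.
move: e1; rewrite size_map size_zip; case: (c_ipos C) h1 => [|p [|]] //= _.
by case: (r_inmv r) => [|a []].
Qed.

Lemma shaped_step M x C : shaped M C -> shaped M (step M [:: x] C).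
Proof.
move=> S; have := step_action x S; case: (action _ _) => [[[q d] ws] ds] [h1 h2 ->].
by split; rewrite //= size_map !size_zip h1 h2 !minnn; case: S => _ ->; rewrite minnn.
Qed.

Lemma shaped_run M x t : shaped M (run M [:: x] t).
Proof.
elim: t => [|t IH]; first by split; rewrite /= ?size_nseq.
by rewrite /run iterS; exact: shaped_step.
Qed.

(** * Local formulas for one step of a machine *)

Definition cell (W : nat -> bool) (j m t i : nat) : bool := W (pr (pr j m) (pr t i)).

Definition FCell (j m : nat) (t i : term) : fml :=
  FBit true (tpr (tpr (TNum j) (TNum m)) (tpr t i)).

Lemma feval_cell x W e j m t i :
  feval x W e (FCell j m t i) = cell W j m (teval (size x) e t) (teval (size x) e i).
Proof. by []. Qed.
Arguments FCell : simpl never.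

(** Injectivity of [pr] lets one bit sequence store a table with four indices. *)
Lemma cell_witness (f : nat -> nat -> nat -> nat -> bool) :
  exists W, forall j m t i, cell W j m t i = f j m t i.
Proof.
pose P z j m t i := z = pr (pr j m) (pr t i) /\ f j m t i.
exists (fun z => `[< exists j m t i, P z j m t i >]) => j m t i; rewrite /cell.
apply/asboolP/idP => [[j' [m' [t' [i' [/pr_inj [/pr_inj [-> ->] /pr_inj [-> ->]] h]]]]]|h] //.
by exists j, m, t, i.
Qed.

Definition TS (t : term) := TAdd t (TNum 1).

(** Since a tape is stored relative to its head, a move is a shift: side [a] gives its first cell to
    the head, and side [c] receives the written symbol. No head position on a work tape is ever
    mentioned. *)
Definition tape_upd (j : nat) (s : Sym) (d : Dir) (b : bool) (t i : term) : fml :=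
  let X side := FCell j.+1 (2 * side + b) in
  let shift a c := FAnds
    [:: FIff (X 2 (TS t) i) (X a t (TNum 0)); FIff (X a (TS t) i) (X a t (TS i));
        FLit (sym_bit b s) (X c (TS t) (TNum 0)); FIff (X c (TS t) (TS i)) (X c t i)] in
  match d with
  | DStay => FAnds [:: FLit (sym_bit b s) (X 2 (TS t) i);
                       FIff (X 0 (TS t) i) (X 0 t i); FIff (X 1 (TS t) i) (X 1 t i)]
  | DLeft => shift 0 1
  | DRight => shift 1 0
  end.

Definition tape_upd_sem (s : Sym) (d : Dir) (b : bool) (F G : nat -> nat -> bool) i : bool :=
  let shift a c := [&& G 2 i == F a 0, G a i == F a i.+1, sym_bit b s == G c 0
                     & G c i.+1 == F c i] in
  match d with
  | DStay => [&& sym_bit b s == G 2 i, G 0 i == F 0 i & G 1 i == F 1 i]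
  | DLeft => shift 0 1
  | DRight => shift 1 0
  end.

Lemma feval_tape_upd x W e j s d b :
  feval x W e (tape_upd j s d b (TVar 0) (TVar 1)) =
  tape_upd_sem s d b (fun m => cell W j.+1 (2 * m + b) (e 0))
    (fun m => cell W j.+1 (2 * m + b) (e 0).+1) (e 1).
Proof. by case: d; rewrite fevalAnds /= !fevalE !feval_cell /= !addn1 ?andbT. Qed.

Lemma tape_upd_complete s d b tp i :
  tape_upd_sem s d b (fun m i => sym_bit b (sym_at m tp i))
    (fun m i => sym_bit b (sym_at m (write_move s d tp) i)) i.
Proof.
case: tp => l c r; rewrite /tape_upd_sem /sym_at /write_move.
case: d => /=; rewrite ?eqxx //; first by case: l => [|a l] /=; rewrite ?nth_nil !eqxx.
by case: r => [|a r] /=; rewrite ?nth_nil !eqxx.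
Qed.

(** The equations fix [G] in terms of [F], and the true successor tape satisfies them too. A shift
    reads cell [i + 1], so one cell of certainty is lost. *)
Lemma tape_upd_sound s d b tp F G N :
  (forall m i, m < 3 -> i <= N.+1 -> F m i = sym_bit b (sym_at m tp i)) ->
  (forall i, i <= N -> tape_upd_sem s d b F G i) ->
  forall m i, m < 3 -> i <= N -> G m i = sym_bit b (sym_at m (write_move s d tp) i).
Proof.
move=> HF HG m i hm hi; have := tape_upd_complete s d b tp; have := HG.
rewrite /tape_upd_sem; case: d {HG} => HG HC.
- have /and4P [/eqP g1 /eqP g2 /eqP g3 /eqP g4] := HG _ hi.
  have /and4P [/eqP c1 /eqP c2 /eqP c3 /eqP c4] := HC i.
  case: m hm => [|[|[|//]]] _; rewrite ?g1 ?g2 ?c1 ?c2 ?HF //.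
  case: i hi g1 g2 g3 g4 c1 c2 c3 c4 => [|i] hi _ _ g3 _ _ _ c3 _; first by rewrite -g3 -c3.
  have /and4P [_ _ _ /eqP g5] := HG i (ltnW hi).
  have /and4P [_ _ _ /eqP c5] := HC i.
  by rewrite g5 c5 HF //; lia.
- have /and4P [/eqP g1 /eqP g2 /eqP g3 /eqP g4] := HG _ hi.
  have /and4P [/eqP c1 /eqP c2 /eqP c3 /eqP c4] := HC i.
  case: m hm => [|[|[|//]]] _; rewrite ?g1 ?g2 ?c1 ?c2 ?HF //.
  case: i hi g1 g2 g3 g4 c1 c2 c3 c4 => [|i] hi _ _ g3 _ _ _ c3 _; first by rewrite -g3 -c3.
  have /and4P [_ _ _ /eqP g5] := HG i (ltnW hi).
  have /and4P [_ _ _ /eqP c5] := HC i.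
  by rewrite g5 c5 HF //; lia.
- have /and3P [/eqP g1 /eqP g2 /eqP g3] := HG _ hi.
  have /and3P [/eqP c1 /eqP c2 /eqP c3] := HC i.
  by case: m hm => [|[|[|//]]] _; rewrite -?g1 ?g2 ?g3 -?c1 ?c2 ?c3 ?HF //; lia.
Qed.

(** A left move at position 0 stays there, so afterwards position 0 is occupied exactly if 0 or 1
    was before. *)
Definition head_upd (d : Dir) (t i : term) : fml :=
  let H := FCell 0 1 in
  match d with
  | DStay => FIff (H (TS t) i) (H t i)
  | DRight => FAnd (FNot (H (TS t) (TNum 0))) (FIff (H (TS t) (TS i)) (H t i))
  | DLeft => FAnd (FIff (H (TS t) (TNum 0)) (FOr (H t (TNum 0)) (H t (TNum 1))))
                  (FIff (H (TS t) (TS i)) (H t (TS (TS i))))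
  end.

Definition head_upd_sem (d : Dir) (F G : nat -> bool) (i : nat) : bool :=
  match d with
  | DStay => G i == F i
  | DRight => ~~ G 0 && (G i.+1 == F i)
  | DLeft => (G 0 == F 0 || F 1) && (G i.+1 == F i.+2)
  end.

Lemma feval_head_upd x W e d :
  feval x W e (head_upd d (TVar 0) (TVar 1)) =
  head_upd_sem d (cell W 0 1 (e 0)) (cell W 0 1 (e 0).+1) (e 1).
Proof.
by case: d; rewrite /head_upd ?fevalE ?feval_cell /= ?addn1.
Qed.

Lemma head_upd_complete d p i :
  head_upd_sem d (fun i => p == i) (fun i => move_pos d p == i) i.
Proof. by case: d; case: p => [|[|p]] //=; rewrite ?eqxx ?eqSS. Qed.

Lemma head_upd_sound d p F G N :
  (forall i, i <= N.+1 -> F i = (p == i)) ->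
  (forall i, i <= N -> head_upd_sem d F G i) ->
  forall i, i <= N -> G i = (move_pos d p == i).
Proof.
move=> HF HG i hi; have HC := head_upd_complete d p.
case: d HG HC => /= HG HC.
- case: i hi => [|i] hi.
    by have /andP [/eqP -> _] := HG 0 hi; have /andP [/eqP -> _] := HC 0; rewrite !HF.
  have /andP [_ /eqP ->] := HG i (ltnW hi); have /andP [_ /eqP ->] := HC i.
  by rewrite HF.
- case: i hi => [|i] hi; first by have /andP [/negbTE -> _] := HG 0 hi.
  by have /andP [_ /eqP ->] := HG i (ltnW hi); rewrite eqSS HF //; lia.
- by rewrite (eqP (HG i hi)) HF //; lia.
Qed.

Lemma all_cons (T : Type) (P : pred T) y s : all P (y :: s) = P y && all P s.
Proof. by []. Qed.

(** The input is blank beyond its length, so a blank is seen when no position below the length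
    carries the head. *)
Definition sees (v : Sym) (t : term) : fml :=
  if v is Some b then FEx 2 TLen (FAnd (FCell 0 1 t (TVar 2)) (FLit b (FBit false (TVar 2))))
  else FNot (FEx 2 TLen (FCell 0 1 t (TVar 2))).

(** [4 + b] is bit [b] of side 2, the scanned cell. *)
Definition key_cond (q : nat) (v : Sym) (vs : seq Sym) (t : term) : fml :=
  FAnds (FCell 0 0 t (TNum q) :: sees v t ::
    [seq FLit (sym_bit b (nth None vs j)) (FCell j.+1 (4 + b) t (TNum 0))
       | j <- iota 0 (size vs), b <- [:: false; true]]).

Definition action_upd (q : nat) (d : Dir) (ws : seq Sym) (ds : seq Dir) (t i : term) : fml :=
  FAnds (FIff (FCell 0 0 (TS t) i) (FEq i (TNum q)) :: head_upd d t i ::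
    [seq tape_upd j (nth None ws j) (nth DStay ds j) b t i
       | j <- iota 0 (size ws), b <- [:: false; true]]).

Lemma all_allpairs_iota (n : nat) (T : Type) (f : nat -> bool -> T) (P : pred T) :
  reflect (forall j b, j < n -> P (f j b))
    (all P [seq f j b | j <- iota 0 n, b <- [:: false; true]]).
Proof.
apply: (iffP all_allpairsP) => H j b; first by move=> hj; apply: H; rewrite ?mem_iota //; case: b.
by rewrite mem_iota => hj _; exact: H.
Qed.

Definition relevant (K j m : nat) : bool := if j is j'.+1 then (j' < K) && (m < 6) else m < 2.

Definition agree (K : nat) (W : nat -> bool) (C : cfg) (t N : nat) : Prop :=
  forall j m i, relevant K j m -> i <= N -> cell W j m t i = field C j m i.

Lemma odd_side side (b : bool) : odd (2 * side + b) = b.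
Proof. by rewrite mul2n oddD odd_double oddb. Qed.

Lemma half_side side (b : bool) : (2 * side + b)./2 = side.
Proof. by rewrite mul2n addnC half_bit_double. Qed.

Lemma field_side C j side (b : bool) i :
  field C j.+1 (2 * side + b) i = sym_bit b (sym_at side (nth blank_tape (c_work C) j) i).
Proof. by rewrite /field odd_side half_side. Qed.

Lemma feval_sees x W e p0 v :
  (forall p, p < size x -> cell W 0 1 (e 0) p = (p0 == p)) ->
  feval x W e (sees v (TVar 0)) = (v == read_input x p0).
Proof.
move=> Hp; case: v => [b|]; rewrite /sees !fevalE [teval _ _ TLen]/=.
- apply/has_iotaP/eqP => [[p hp]|].
    rewrite !fevalE feval_cell /= upd_same /upd /= Hp // => /andP [/eqP -> /eqP ->].
    by rewrite /read_input (nth_map false).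
  move=> E; have hp : p0 < size x.
    by rewrite ltnNge; apply/negP => h; move: E; rewrite /read_input nth_default ?size_map.
  exists p0 => //; rewrite !fevalE feval_cell /= upd_same /upd /= Hp // eqxx /=.
  by move: E; rewrite /read_input (nth_map false) // => -[->].
- apply/idP/eqP => [H|E].
    rewrite /read_input nth_default ?size_map // leqNgt; apply: contra H => h.
    by apply/has_iotaP; exists p0 => //; rewrite feval_cell /= upd_same /upd /= Hp.
  apply/has_iotaP => -[p hp]; rewrite feval_cell /= upd_same /upd /= Hp // => /eqP e0.
  by move: E; rewrite e0 /read_input (nth_map false).
Qed.

Lemma feval_key_cond M x W e C N q v vs :
  shaped M C -> agree (tm_nwork M) W C (e 0) N -> size x <= N -> c_q C <= N ->
  size vs = tm_nwork M -> q <= N ->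
  feval x W e (key_cond q v vs (TVar 0)) = ((q, v, vs) == ckey x C).
Proof.
case=> [h1 h2] A hx hq hk hqN.
rewrite fevalAnds !all_cons feval_cell [teval _ _ _]/= A // /field /ckey !xpair_eqE -andbA.
rewrite [q == _]eq_sym; congr (_ && _).
have Hp : forall p, p < size x -> cell W 0 1 (e 0) p = (head 0 (c_ipos C) == p).
  by move=> p hp; rewrite A // (leq_trans (ltnW hp)).
rewrite (feval_sees v Hp); congr (_ && _).
apply/all_allpairs_iota/eqP => [H|-> j b hj].
- apply: (@eq_from_nth _ None); rewrite ?size_map ?hk // => j hj.
  apply: sym_bit_inj => b; have := H j b; rewrite hk hj fevalLit feval_cell /= => /(_ isT) /eqP ->.
  rewrite A ?(field_side C j 2) //=; first by rewrite (nth_map blank_tape) ?h2.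
  by case: b; rewrite hj.
- have hj' : j < tm_nwork M by rewrite -h2 -(size_map t_cur).
  rewrite fevalLit feval_cell /= A ?(field_side C j 2) //=; last by case: b; rewrite hj'.
  by rewrite (nth_map blank_tape) ?h2.
Qed.

Lemma field_step M x C j m i : shaped M C -> relevant (tm_nwork M) j m ->
  let: (q, d, ws, ds) := action M (ckey x C) in
  field (step M [:: x] C) j m i =
  match j with
  | 0 => if m is 0 then q == i else move_pos d (head 0 (c_ipos C)) == i
  | j'.+1 => sym_bit (odd m) (sym_at m./2
      (write_move (nth None ws j') (nth DStay ds j') (nth blank_tape (c_work C) j')) i)
  end.
Proof.
move=> S; have := step_action x S; case: (action _ _) => [[[q d] ws] ds] [h1 h2 ->].
case: j => //= j /andP [hj _]; case: S => _ h3.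
rewrite (nth_map (None, DStay, blank_tape)) ?size_zip ?h1 ?h2 ?h3 ?minnn //.
by rewrite !nth_zip ?size_zip ?h1 ?h2 ?h3 ?minnn.
Qed.

Lemma action_upd_complete M x W e C :
  shaped M C -> (forall N, agree (tm_nwork M) W C (e 0) N) ->
  (forall N, agree (tm_nwork M) W (step M [:: x] C) (e 0).+1 N) ->
  let: (q, d, ws, ds) := action M (ckey x C) in
  feval x W e (action_upd q d ws ds (TVar 0) (TVar 1)).
Proof.
move=> S A A'; have FS := fun j m i => field_step x i S (j := j) (m := m).
have := step_action x S; case: (action M (ckey x C)) FS => [[[q d] ws] ds] FS [h1 h2 h3].
rewrite fevalAnds !all_cons; apply/and3P; split.
- by rewrite !fevalE feval_cell /= addn1 (A' (e 1)) // FS // [q == _]eq_sym eqxx.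
- have E i : cell W 0 1 (e 0) i = (head 0 (c_ipos C) == i) by rewrite (A i).
  have E' i : cell W 0 1 (e 0).+1 i = (move_pos d (head 0 (c_ipos C)) == i) by rewrite (A' i) // FS.
  rewrite feval_head_upd; have := head_upd_complete d (head 0 (c_ipos C)) (e 1).
  by rewrite /head_upd_sem; case: d E' {h3 FS} => E'; rewrite !E ?E'.
apply/all_allpairs_iota => j b; rewrite h1 => hj; rewrite feval_tape_upd.
have R m : m < 3 -> relevant (tm_nwork M) j.+1 (2 * m + b).
  by rewrite /relevant hj /=; case: b; lia.
have := tape_upd_complete (nth None ws j) (nth DStay ds j) b (nth blank_tape (c_work C) j) (e 1).
have E m i : m < 3 -> cell W j.+1 (2 * m + b) (e 0) i = sym_bit b (sym_at m (nth blank_tape (c_work C) j) i).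
  by move=> hm; rewrite (A i) ?R ?field_side.
have E' m i : m < 3 -> cell W j.+1 (2 * m + b) (e 0).+1 i =
    sym_bit b (sym_at m (write_move (nth None ws j) (nth DStay ds j) (nth blank_tape (c_work C) j)) i).
  by move=> hm; rewrite (A' i) ?R // FS ?R // odd_side half_side.
by rewrite /tape_upd_sem; case: (nth DStay ds j) E' => E'; rewrite !E ?E'.
Qed.

Lemma action_upd_sound M x W C t N :
  shaped M C -> agree (tm_nwork M) W C t N.+1 ->
  (forall i, i <= N ->
     let: (q, d, ws, ds) := action M (ckey x C) in
     feval x W (upd (upd (fun=> 0) 0 t) 1 i) (action_upd q d ws ds (TVar 0) (TVar 1))) ->
  agree (tm_nwork M) W (step M [:: x] C) t.+1 N.
Proof.
move=> S A H j m i rel hi; have := field_step x i S rel.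
have := step_action x S.
case: (action M (ckey x C)) H => [[[q d] ws] ds] H [h1 h2 h3] ->.
case: j rel => [|j] rel.
  case: m rel => [|[|//]] _.
    by have := H i hi; rewrite fevalAnds !all_cons => /andP []; rewrite !fevalE feval_cell /= addn1 => /eqP ->; rewrite eq_sym.
  move: i hi; apply: (@head_upd_sound d _ (cell W 0 1 t)) => [i hi|i hi]; first by rewrite A.
  by have := H i hi; rewrite fevalAnds !all_cons => /and3P [_]; rewrite feval_head_upd.
have /andP [hj hm] := rel.
have Em : m = 2 * m./2 + odd m by rewrite -[LHS]odd_double_half mul2n addnC.
have hm2 : m./2 < 3 by lia.
rewrite {1}Em; move: (odd m) (m./2) hm2 => b s hs {Em hm rel m}.
have R m : m < 3 -> relevant (tm_nwork M) j.+1 (2 * m + b).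
  by rewrite /relevant hj /=; case: b; lia.
apply: (@tape_upd_sound (nth None ws j) (nth DStay ds j) b _
  (fun m => cell W j.+1 (2 * m + b) t) (fun m => cell W j.+1 (2 * m + b) t.+1) N) => // [m k hm hk|k hk].
  by rewrite A ?R // field_side.
have := H k hk; rewrite fevalAnds !all_cons => /and3P [_ _ /all_allpairs_iota].
by move/(_ j b); rewrite h1 hj feval_tape_upd => /(_ isT).
Qed.

(** * The tableau of a run *)

Definition max_state (M : TM) : nat := foldr maxn 2 (map r_q' (tm_rules M)).

Lemma run_max_state M xs t : c_q (run M xs t) <= max_state M.
Proof.
elim: t => // t IH; rewrite /run iterS -/(run M xs t) /step; case: ifP => // _.
case R : (ohead _) => [r|] //=; rewrite /max_state.
elim: (tm_rules M) R => //= a l IHl; case: ifP => _ /=.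
  by case=> <-; exact: leq_maxl.
by move=> /IHl h; exact: leq_trans h (leq_maxr _ _).
Qed.

Lemma max_state_ge2 M : 2 <= max_state M.
Proof. by rewrite /max_state; elim: (map _ _) => //= a l IH; exact: leq_trans IH (leq_maxr _ _). Qed.

Definition skeys (M : TM) : seq skey :=
  [seq (qv, vs) | qv <- [seq (q, v) | q <- iota 0 (max_state M).+1,
                                      v <- [:: None; Some false; Some true]],
                  vs <- sym_vecs (tm_nwork M)].

Lemma mem_skeys M q v vs :
  ((q, v, vs) \in skeys M) = (q <= max_state M) && (size vs == tm_nwork M).
Proof.
apply/allpairsP/andP.
  case=> -[[q' v'] vs'] [/allpairsP [[q2 v2] [h1 _ e]] h3 e'].
  case: e' => -> _ ->; rewrite (sym_vecs_size h3) eqxx; split=> //.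
  by case: e => -> _; move: h1; rewrite mem_iota add0n ltnS.
case=> h1 /eqP h2; exists ((q, v), vs); split => //; last exact: mem_sym_vecs.
apply/allpairsP; exists (q, v); split => //; first by rewrite mem_iota.
by case: v => [[]|].
Qed.

(** Variable 0 is the time and variable 1 the cell. *)
Definition key_step (M : TM) (k : skey) : fml :=
  let: (q, v, vs) := k in let: (q', d, ws, ds) := action M k in
  FImp (key_cond q v vs (TVar 0)) (action_upd q' d ws ds (TVar 0) (TVar 1)).

Definition tab_init (M : TM) (B : term) : fml :=
  FAll 1 (TS B) (FAnds
    (FIff (FCell 0 0 (TNum 0) (TVar 1)) (FEq (TVar 1) (TNum q_init)) ::
     FIff (FCell 0 1 (TNum 0) (TVar 1)) (FEq (TVar 1) (TNum 0)) ::
     [seq FNot (FCell j.+1 m (TNum 0) (TVar 1)) | j <- iota 0 (tm_nwork M), m <- iota 0 6])).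

(* Only the cells with [i + t <= B] are constrained, and a step moves
   information by one cell, so the constrained cells are determined. *)
Definition tab_step (M : TM) (T B : term) : fml :=
  FAll 0 T (FAll 1 (TS B)
    (FImp (FLe (TAdd (TVar 1) (TS (TVar 0))) B) (FAnds (map (key_step M) (skeys M))))).

(** After [t] steps the cells up to [B - t] are still determined. The choice of [B] leaves, even at
    time [T], a margin that covers all input positions and the one-hot row of states. *)
Definition tableau (M : TM) (q : nat) (T : term) : fml :=
  let B := TAdd T (TAdd TLen (TNum (max_state M))) in
  FAnds [:: tab_init M B; tab_step M T B; FCell 0 0 T (TNum q)].

Lemma field_init M x j m i : relevant (tm_nwork M) j m ->
  field (init_cfg M [:: x]) j m i = if j is 0 then i == 0 else false.
Proof.
case: j => [|j] /=; first by case: m => [|[]] //; rewrite eq_sym.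
case/andP => hj _; rewrite nth_nseq hj.
by case: (m./2) => [|[|s]] /=; rewrite ?nth_nil; case: odd.
Qed.

Lemma feval_tableau M q x T t0 : q <= 2 ->
  (forall e, teval (size x) e T = t0) ->
  (exists W, feval x W (fun=> 0) (tableau M q T)) <-> c_q (run M [:: x] t0) = q.
Proof.
move=> q2 HT; set Q := max_state M; pose B := t0 + (size x + Q).
have q2' : q <= Q := leq_trans q2 (max_state_ge2 M).
split=> [[W]|Hq].
  rewrite fevalAnds !all_cons andbT => /and3P [Hi Hs Hf].
  have A t : t <= t0 -> agree (tm_nwork M) W (run M [:: x] t) t (B - t).
    elim: t => [|t IH] ht.
      move=> j m i rel; rewrite subn0 => hi; rewrite field_init //.
      move: Hi; rewrite /tab_init fevalAll => /all_iotaP /(_ i).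
      rewrite [teval _ _ _]/= !HT -/Q -/B addn1 ltnS hi => /(_ isT).
      rewrite fevalAnds !all_cons !fevalE !feval_cell => /and3P [h1 h2 /all_allpairsP h3].
      move: h1 h2; rewrite /upd /= => /eqP h1 /eqP h2.
      case: j rel => [|j] rel; first by case: m rel => [|[|]].
      have /andP [hj hm] := rel.
      by have := h3 j m; rewrite !mem_iota hj hm !fevalE feval_cell /= => /(_ isT isT) /negbTE ->.
    have {}IH := IH (ltnW ht).
    have -> : run M [:: x] t.+1 = step M [:: x] (run M [:: x] t) by rewrite /run iterS.
    have E : B - t = (B - t.+1).+1 by rewrite /B; lia.
    rewrite E in IH; apply: (action_upd_sound (shaped_run M x t) IH).
    move=> i hi; set C := run M [:: x] t; set e := upd _ 1 i.
    have hk : ckey x C \in skeys M.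
      rewrite /ckey mem_skeys run_max_state size_map.
      by case: (shaped_run M x t) => _ ->; rewrite eqxx.
    have iB : i + t.+1 <= B by move: hi; rewrite /B; lia.
    move: Hs; rewrite /tab_step fevalAll HT => /all_iotaP /(_ t ht).
    rewrite fevalAll => /all_iotaP /(_ i).
    rewrite /= !HT -/Q -/B addn1 ltnS => /(_ (leq_trans (leq_addr _ _) iB)).
    rewrite fevalImp fevalLe /= !HT -/Q -/B addn1 {1}/upd /= {1}/upd /= {1}/upd /= iB /=.
    rewrite fevalAnds all_map => /allP /(_ _ hk) /=.
    have KC := @feval_key_cond M x W e C (B - t.+1).+1 _ _ _ (shaped_run M x t) IH.
    rewrite /key_step -/(ckey x C); case: (action _ _) => [[[q' d] ws] ds].
    rewrite fevalImp KC ?eqxx //.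
    + by rewrite /B; lia.
    + by have := run_max_state M [:: x] t; rewrite -/C -/Q /B; lia.
    + by rewrite size_map; case: (shaped_run M x t).
    + by have := run_max_state M [:: x] t; rewrite -/C -/Q /B; lia.
  have hA : cell W 0 0 t0 q = field (run M [:: x] t0) 0 0 q by apply: (A t0) => //; rewrite /B; lia.
  by move: Hf; rewrite feval_cell HT /= hA => /eqP.
(* For the converse the run itself is the witness. *)
have [W HW] := cell_witness (fun j m t i => field (run M [:: x] t) j m i).
exists W; rewrite fevalAnds !all_cons andbT; apply/and3P; split.
- rewrite /tab_init fevalAll; apply/all_iotaP => i _.
  rewrite fevalAnds !all_cons; apply/and3P; split.
  + by rewrite !fevalE feval_cell HW field_init.
  + by rewrite !fevalE feval_cell HW field_init.
  + apply/all_allpairsP => j m; rewrite !mem_iota => hj hm.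
    by rewrite fevalNot feval_cell HW field_init //; apply/andP.
- rewrite /tab_step fevalAll HT; apply/all_iotaP => t ht; rewrite fevalAll; apply/all_iotaP => i _.
  rewrite fevalImp; apply/implyP => hB; rewrite fevalAnds all_map; apply/allP => -[[a v] vs] hk /=.
  set e := upd _ 1 i; set C := run M [:: x] t.
  have Ag t' N : agree (tm_nwork M) W (run M [:: x] t') t' N by move=> j m k _ _; exact: HW.
  move: hk; rewrite mem_skeys => /andP [h1 /eqP h2].
  have KC := @feval_key_cond M x W e C (size x + Q) a v vs (shaped_run M x t) (Ag t _).
  have UC := @action_upd_complete M x W e C (shaped_run M x t) (Ag t).
  move: KC UC; rewrite /key_step; case: eqP => [->|ne] KC.
    case: (action _ _) => [[[q' d] ws] ds] UC; rewrite fevalImp UC ?implybT //.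
    by move=> N; have := Ag t.+1 N; rewrite /run iterS.
  by move=> _; case: (action _ _) => [[[q' d] ws] ds]; rewrite fevalImp KC //;
    have := run_max_state M [:: x] t; rewrite -/C -/Q; lia.
- by rewrite feval_cell HT HW /= Hq eqxx.
Qed.

(** When the polynomial clock expires the run has halted, and either verdict says that the tableau
    ends in a given final state; acceptance and rejection are thus both existential. *)
Lemma P_sigma11 (L : language) : P_class L ->
  sigma11 (fun x => L x) /\ sigma11 (fun x => ~ L x).
Proof.
case=> M [d [K HK]].
pose T := TAdd (TMul (TNum K) (texp TLen d)) (TNum K).
have HT (x : seq bool) e : teval (size x) e T = K * size x ^ d + K.
  exact: (congr1 (fun y => K * y + K) (teval_texp x e TLen d)).
have HO x : outcome M [:: x] (K * size x ^ d + K) = Some (L x).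
  have [t [lt Ht]] := HK x; apply: outcome_stable Ht _; by rewrite -Nat_powE.
split; [exists (tableau M q_acc T)|exists (tableau M q_rej T)] => x.
all: rewrite (@feval_tableau M _ x T (K * size x ^ d + K)) //; have := HO x; rewrite /outcome.
all: case: eqP => [-> [<-]|ne]; first by split.
all: case: eqP => [-> [<-]|ne'] //; by split.
Qed.

Lemma sigma11_compl (A : seq bool -> Prop) :
  P_class = NP_class -> sigma11 A -> sigma11 (fun x => ~ A x).
Proof.
move=> E HA; pose L : language := fun x => `[< A x >].
have LA x : L x <-> A x by split => [/asboolP|/asboolP].
have : NP_class L.
  by apply: sigma11_NP; case: HA => f Hf; exists f => x; rewrite -Hf.
rewrite -E => /P_sigma11 [_ [f Hf]]; exists f => x.
by rewrite -Hf LA.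
Qed.

(** * Kannan's diagonal language *)

Fixpoint tsub (l t : term) : term :=
  match t with
  | TLen => l
  | TAdd a b => TAdd (tsub l a) (tsub l b)
  | TMul a b => TMul (tsub l a) (tsub l b)
  | _ => t
  end.

(* Replaces the input by the string of length [l] whose bits are the cells
   [pr k0 i] of the witness, and the witness by its section [pr k1]. *)
Fixpoint fsub (l : term) (k0 k1 : nat) (f : fml) : fml :=
  match f with
  | FLt a b => FLt (tsub l a) (tsub l b)
  | FBit b t =>
      if b then FBit true (tpr (TNum k1) (tsub l t))
      else FAnd (FLt (tsub l t) l) (FBit true (tpr (TNum k0) (tsub l t)))
  | FNot g => FNot (fsub l k0 k1 g)
  | FAnd g h => FAnd (fsub l k0 k1 g) (fsub l k0 k1 h)
  | FEx v t g => FEx v (tsub l t) (fsub l k0 k1 g)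
  end.

Lemma teval_tsub n l N e t : (forall e, teval n e l = N) ->
  teval n e (tsub l t) = teval N e t.
Proof. by move=> H; elim: t => //= a -> b ->. Qed.

Lemma feval_fsub x W e l N k0 k1 f : (forall e, teval (size x) e l = N) ->
  feval x W e (fsub l k0 k1 f) =
  feval (mkseq (fun i => W (pr k0 i)) N) (fun i => W (pr k1 i)) e f.
Proof.
move=> H; elim: f e => [a b|b t|g IH|g IHg h IHh|v t g IH] e.
- by rewrite /= !fevalE !(teval_tsub _ _ H) size_mkseq.
- case: b; rewrite /feval /= !(teval_tsub _ _ H) size_mkseq ?H //.
  case: ltnP => h /=; first by rewrite nth_mkseq.
  by rewrite nth_default // size_mkseq.
- by rewrite /= !fevalE IH.
- by rewrite /= !fevalE IHg IHh.
- rewrite /= !fevalE (teval_tsub _ _ H) size_mkseq; apply: eq_has => k; exact: IH.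
Qed.

(* A matrix presentation of circuits evaluated on the inputs with ones exactly
   at [a], [b], [c]: vertex [k] outputs [tau k] xor the conjunction of the
   vertices [j < k] selected by [P], the negated ones selected by [Q] and the
   input bits selected by [I]. *)
Definition gate_at (n : nat) (P Q I : nat -> nat -> bool) (tau : nat -> bool)
    (V : nat -> nat -> nat -> nat -> bool) (k a b c : nat) : bool :=
  V k a b c == ~~ (tau k ==
    (all (fun j => (P k j ==> V j a b c) && (Q k j ==> ~~ V j a b c)) (iota 0 k) &&
     all (fun j => I k j ==> [|| j == a, j == b | j == c]) (iota 0 n))).

(** [s ^ 3 <= n ^ 4] is the integer form of the bound n^(4/3). [V] lists the values of all vertices
    on all inputs, so that evaluation becomes a local check. Only increasing triples are compared,
    one for each set of three positions. *)
Definition easy_table (n : nat) (T : nat -> nat -> nat -> bool) : Prop :=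
  exists s P Q I tau V,
  [/\ 0 < s, s ^ 3 <= n ^ 4,
      forall k a b c, k < s -> a < n -> b < n -> c < n -> gate_at n P Q I tau V k a b c &
      forall a b c, a < b -> b < c -> c < n -> V s.-1 a b c = T a b c].

Definition table_of (n : nat) (u : seq bool) (a b c : nat) : bool :=
  nth false u ((a * n + b) * n + c).

Definition easy (u : seq bool) : Prop :=
  exists2 n, n ^ 3 = size u & easy_table n (table_of n u).

(** The vertex values are stored in [cell] with first index [pr 1 k], which is positive and so
    avoids group 0, where [P], [Q], [I] and [tau] are stored. *)
Definition FV (k a b c : nat) : fml :=
  FBit true (tpr (tpr (tpr (TNum 1) (TVar k)) (TVar a)) (tpr (TVar b) (TVar c))).
Arguments FV : simpl never.

Lemma feval_FV x W e k a b c :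
  feval x W e (FV k a b c) = cell W (pr 1 (e k)) (e a) (e b) (e c).
Proof. by []. Qed.

(* Variables: 0 is n, 1 is s, 2 is k, 3 is j and 4, 5, 6 are a, b, c. *)
Definition gate_fml : fml :=
  FIff (FV 2 4 5 6) (FNot (FIff (FCell 0 3 (TVar 2) (TNum 0))
    (FAnd
      (FAll 3 (TVar 2) (FAnd (FImp (FCell 0 0 (TVar 2) (TVar 3)) (FV 3 4 5 6))
                             (FImp (FCell 0 1 (TVar 2) (TVar 3)) (FNot (FV 3 4 5 6)))))
      (FAll 3 (TVar 0) (FImp (FCell 0 2 (TVar 2) (TVar 3))
         (FOr (FEq (TVar 3) (TVar 4)) (FOr (FEq (TVar 3) (TVar 5)) (FEq (TVar 3) (TVar 6))))))))).

Lemma feval_gate_fml x W e :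
  feval x W e gate_fml =
  gate_at (e 0) (cell W 0 0) (cell W 0 1) (cell W 0 2) (fun k => cell W 0 3 k 0)
    (fun k => cell W (pr 1 k)) (e 2) (e 4) (e 5) (e 6).
Proof.
rewrite /gate_fml /gate_at !fevalE feval_FV feval_cell; congr (_ == ~~ (_ == _ && _)).
  by apply: eq_all => j; rewrite !fevalE !feval_FV !feval_cell.
by apply: eq_all => j; rewrite !fevalE !feval_cell.
Qed.

Definition easy_fml : fml :=
  FEx 0 (TS TLen) (FAnd (FEq (texp (TVar 0) 3) TLen)
    (FEx 1 (TS TLen) (FAnd (FAnd (FLt (TNum 0) (TVar 1))
                                 (FLe (texp (TVar 1) 3) (texp (TVar 0) 4)))
      (FAnd
        (FAll 2 (TVar 1) (FAll 4 (TVar 0) (FAll 5 (TVar 0) (FAll 6 (TVar 0) gate_fml))))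
        (FAll 2 (TVar 1) (FImp (FEq (TS (TVar 2)) (TVar 1))
          (FAll 4 (TVar 0) (FAll 5 (TVar 0) (FAll 6 (TVar 0)
            (FImp (FAnd (FLt (TVar 4) (TVar 5)) (FLt (TVar 5) (TVar 6)))
              (FIff (FV 2 4 5 6)
                (FBit false (TAdd (TMul (TAdd (TMul (TVar 4) (TVar 0)) (TVar 5)) (TVar 0))
                                  (TVar 6)))))))))))))).

Lemma sigma11_easy : sigma11 easy.
Proof.
exists easy_fml => u; split.
  case=> n Hn [s [P [Q [I [tau [V [s0 hs HG HO]]]]]]].
  have [W HW] := cell_witness (fun J m t i =>
    if J == 0 then (match m with 0 => P t i | 1 => Q t i | 2 => I t i | _ => tau t end)
    else `[< exists2 k, J = pr 1 k & V k m t i >]).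
  have HV k a b c : cell W (pr 1 k) a b c = V k a b c.
    rewrite HW; have -> : pr 1 k == 0 = false by rewrite /pr; lia.
    by apply/asboolP/idP => [[k' /pr_inj [_ ->]]|h] //; exists k.
  exists W; rewrite /easy_fml fevalEx; apply/has_iotaP; exists n.
    rewrite /= -Hn addn1 ltnS; case: n {Hn hs HG HO} => // n; rewrite expnS leq_pmulr // expn_gt0.
  rewrite fevalAnd fevalEq teval_texp /= upd_same Hn eqxx /=.
  rewrite fevalEx; apply/has_iotaP; exists s.
    (* [s] is within the range of its quantifier since [s ^ 3 <= n ^ 4 <= n ^ 9], and the input has
       length [n ^ 3]. *)
    rewrite /= addn1 ltnS -Hn -(@leq_exp2r _ _ 3) //; apply: leq_trans hs _.
    by case: n {Hn HG HO} => // n; rewrite -expnM leq_pexp2l.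
  rewrite fevalAnd; apply/andP; split.
    by rewrite fevalAnd fevalLt fevalLe !teval_texp /= /upd /= s0 hs.
  rewrite fevalAnd; apply/andP; split.
    rewrite !fevalAll; apply/all_iotaP => k hk.
    rewrite !fevalAll; apply/all_iotaP => a ha.
    rewrite !fevalAll; apply/all_iotaP => b hb.
    rewrite !fevalAll; apply/all_iotaP => c hc.
    rewrite feval_gate_fml /upd /=.
    suff -> : gate_at n (cell W 0 0) (cell W 0 1) (cell W 0 2) (fun k => cell W 0 3 k 0)
        (fun k => cell W (pr 1 k)) k a b c = gate_at n P Q I tau V k a b c by exact: HG.
    by congr gate_at; do ?(apply: funext => ?); rewrite ?HV ?HW.
  rewrite !fevalAll; apply/all_iotaP => k hk; rewrite fevalImp fevalEq; apply/implyP.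
  rewrite /= /upd /= addn1 => /eqP ks.
  rewrite !fevalAll; apply/all_iotaP => a ha.
  rewrite !fevalAll; apply/all_iotaP => b hb.
  rewrite !fevalAll; apply/all_iotaP => c hc.
  rewrite fevalImp fevalAnd !fevalLt; apply/implyP => /andP [].
  rewrite /= /upd /= => ab bc; rewrite fevalIff feval_FV fevalBit0 /= HV.
  by rewrite -[_ == _]/(V k a b c == table_of n u a b c) -HO // -ks.
case=> W; rewrite /easy_fml fevalEx => /has_iotaP [n hn].
rewrite fevalAnd fevalEq teval_texp /= upd_same => /andP [/eqP Hn].
rewrite fevalEx => /has_iotaP [s hs]; rewrite fevalAnd => /andP [].
rewrite fevalAnd fevalLt fevalLe !teval_texp /= /upd /= => /andP [s0 sn].
rewrite fevalAnd => /andP [H1 H2]; exists n => //.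
exists s, (cell W 0 0), (cell W 0 1), (cell W 0 2), (fun k => cell W 0 3 k 0), (fun k => cell W (pr 1 k)).
split=> // [k a b c hk ha hb hc|a b c ab bc hc].
  move: H1; rewrite fevalAll => /all_iotaP /(_ k hk).
  rewrite fevalAll => /all_iotaP /(_ a ha).
  rewrite fevalAll => /all_iotaP /(_ b hb).
  rewrite fevalAll => /all_iotaP /(_ c hc).
  by rewrite feval_gate_fml.
have hs1 : s.-1 < s by case: (s) s0.
move: H2; rewrite fevalAll => /all_iotaP /(_ s.-1 hs1).
rewrite fevalImp fevalEq /= /upd /= addn1 prednK // eqxx /=.
rewrite fevalAll => /all_iotaP /(_ a (ltn_trans ab (ltn_trans bc hc))).
rewrite fevalAll => /all_iotaP /(_ b (ltn_trans bc hc)).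
rewrite fevalAll => /all_iotaP /(_ c hc).
rewrite fevalImp fevalAnd !fevalLt /= /upd /= ab bc /=.
by rewrite fevalIff feval_FV fevalBit0 /= => /eqP ->.
Qed.

(** * The lexicographically first hard table *)

Lemma section_witness (f : nat -> nat -> bool) : exists W, forall k i, W (pr k i) = f k i.
Proof.
exists (fun z => `[< exists k i, z = pr k i /\ f k i >]) => k i.
by apply/asboolP/idP => [[k' [i' [/pr_inj [-> ->] h]]]|h] //; exists k, i.
Qed.

Definition lexlt (u v : seq bool) : Prop :=
  exists2 j, j < size v & [/\ nth false v j, ~~ nth false u j &
    forall i, i < j -> nth false v i = nth false u i].

(** Hardness of [u'] is existential under the collapse, hence so is this predicate; a second
    complementation then expresses that no smaller table is hard. *)
Definition late (u : seq bool) : Prop :=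
  exists u', [/\ size u' = size u, lexlt u' u & ~ easy u'].

Lemma mkseq_nth_size (u : seq bool) n : size u = n -> mkseq (nth false u) n = u.
Proof. by move=> <-; exact: mkseq_nth. Qed.

Lemma sigma11_late : sigma11 (fun u => ~ easy u) -> sigma11 late.
Proof.
case=> f Hf.
pose l := FEx 0 TLen (FAnd (FAnd (FBit false (TVar 0)) (FNot (FBit true (tpr (TNum 0) (TVar 0)))))
  (FAll 1 (TVar 0) (FIff (FBit false (TVar 1)) (FBit true (tpr (TNum 0) (TVar 1)))))).
have Hl u W : feval u W (fun=> 0) l <-> lexlt (mkseq (fun i => W (pr 0 i)) (size u)) u.
  rewrite /l fevalEx; split.
    case/has_iotaP => j hj; rewrite !fevalAnd fevalAll => /andP [/andP [h1 h2] /all_iotaP h3].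
    exists j => //; rewrite nth_mkseq //; split => // i hi.
    have := h3 i hi; rewrite fevalIff => /eqP; rewrite nth_mkseq //; exact: ltn_trans hi hj.
  case=> j hj [h1 h2 h3]; apply/has_iotaP; exists j => //.
  rewrite nth_mkseq // in h2.
  rewrite !fevalAnd fevalAll; apply/andP; split; first by apply/andP.
  apply/all_iotaP => i hi; rewrite fevalIff; apply/eqP.
  have := h3 i hi; rewrite nth_mkseq //; exact: ltn_trans hi hj.
exists (FAnd l (fsub TLen 0 1 f)) => u; split.
  case=> u' [su lt /Hf [W1 HW1]].
  have [W HW] := section_witness (fun k => if k is 0 then nth false u' else W1).
  have E0 : (fun i => W (pr 0 i)) = nth false u' by apply: funext => i; rewrite HW.
  have E1 : (fun i => W (pr 1 i)) = W1 by apply: funext => i; rewrite HW.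
  exists W; rewrite fevalAnd (@feval_fsub _ _ _ _ (size u)) // E0 E1 mkseq_nth_size // HW1 andbT.
  by apply/Hl; rewrite E0 mkseq_nth_size.
case=> W; rewrite fevalAnd (@feval_fsub _ _ _ _ (size u)) // => /andP [/Hl h1 h2].
exists (mkseq (fun i => W (pr 0 i)) (size u)); split => //; first by rewrite size_mkseq.
by apply/Hf; exists (fun i => W (pr 1 i)).
Qed.

(* On inputs with exactly three ones this reads off the first hard table. *)
Definition first_hard (x : seq bool) : Prop :=
  exists u, [/\ size u = size x ^ 3, ~ easy u, ~ late u &
    exists a b c, [/\ a < b, b < c, c < size x,
      [&& nth false x a, nth false x b & nth false x c] & table_of (size x) u a b c]].

Lemma sigma11_first_hard :
  sigma11 (fun u => ~ easy u) -> sigma11 (fun u => ~ late u) -> sigma11 first_hard.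
Proof.
case=> f Hf [g Hg].
pose N := texp TLen 3.
have HN n e : teval n e N = n ^ 3 by have := teval_texp (nseq n true) e TLen 3; rewrite size_nseq.
pose t := FEx 0 TLen (FEx 1 TLen (FEx 2 TLen (FAnd
  (FAnd (FLt (TVar 0) (TVar 1)) (FLt (TVar 1) (TVar 2)))
  (FAnd (FAnd (FBit false (TVar 0)) (FAnd (FBit false (TVar 1)) (FBit false (TVar 2))))
    (FBit true (tpr (TNum 0) (TAdd (TMul (TAdd (TMul (TVar 0) TLen) (TVar 1)) TLen) (TVar 2)))))))).
have Hbound n a b c : a < n -> b < n -> c < n -> (a * n + b) * n + c < n ^ 3.
  move=> ha hb hc; rewrite !expnS expn0 muln1 mulnA.
  have : a * n + b < n * n by nia.
  by nia.
have Ht x W : feval x W (fun=> 0) t <-> exists a b c, [/\ a < b, b < c, c < size x,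
      [&& nth false x a, nth false x b & nth false x c] &
      table_of (size x) (mkseq (fun i => W (pr 0 i)) (size x ^ 3)) a b c].
  rewrite /t !fevalEx; split.
    case/has_iotaP => a ha; rewrite fevalEx => /has_iotaP [b hb]; rewrite fevalEx => /has_iotaP [c hc].
    rewrite /feval /upd /= => /and3P [/andP [h1 h2] h3 h4]; exists a, b, c; split => //.
    by rewrite /table_of nth_mkseq //; exact: Hbound.
  case=> a [b [c [ab bc cx hx hT]]].
  have bx := ltn_trans bc cx; have ax := ltn_trans ab bx.
  apply/has_iotaP; exists a => //; rewrite fevalEx.
  apply/has_iotaP; exists b => //; rewrite fevalEx; apply/has_iotaP; exists c => //.
  rewrite /feval /upd /= ab bc hx /=; move: hT; rewrite /table_of nth_mkseq //; exact: Hbound.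
exists (FAnd t (FAnd (fsub N 0 1 f) (fsub N 0 2 g))) => x; split.
  case=> u [su /Hf [W1 HW1] /Hg [W2 HW2] HT].
  have [W HW] := section_witness (fun k => match k with 0 => nth false u | 1 => W1 | _ => W2 end).
  have E0 : (fun i => W (pr 0 i)) = nth false u by apply: funext => i; rewrite HW.
  have E1 : (fun i => W (pr 1 i)) = W1 by apply: funext => i; rewrite HW.
  have E2 : (fun i => W (pr 2 i)) = W2 by apply: funext => i; rewrite HW.
  exists W; rewrite !fevalAnd !(@feval_fsub _ _ _ N (size x ^ 3)) // E0 E1 E2 mkseq_nth_size // HW1 HW2 !andbT.
  by apply/Ht; rewrite E0 mkseq_nth_size.
case=> W; rewrite !fevalAnd !(@feval_fsub _ _ _ N (size x ^ 3)) // => /and3P [/Ht h1 h2 h3].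
exists (mkseq (fun i => W (pr 0 i)) (size x ^ 3)); split => //; first by rewrite size_mkseq.
- by apply/Hf; exists (fun i => W (pr 1 i)).
- by apply/Hg; exists (fun i => W (pr 2 i)).
Qed.

Lemma first_hard_P : P_class = NP_class ->
  exists2 L, P_class L & forall x, L x <-> first_hard x.
Proof.
move=> E; exists (fun x => `[< first_hard x >]); last by move=> x; split => /asboolP.
have h1 := sigma11_compl E sigma11_easy.
have h2 := sigma11_compl E (sigma11_late h1).
rewrite E; apply: sigma11_NP; case: (sigma11_first_hard h1 h2) => f Hf.
by exists f => x; rewrite -Hf; split => /asboolP.
Qed.

Lemma lexlt_cons b u v : lexlt u v -> lexlt (b :: u) (b :: v).
Proof.
case=> j hj [h1 h2 h3]; exists j.+1 => //; split => // -[|i] //= hi; exact: h3.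
Qed.

(** The minimum is found bit by bit: the next bit is [false] whenever some member of [A] allows
    it. *)
Lemma lexmin_exists n (A : seq bool -> Prop) :
  (exists u, size u = n /\ A u) ->
  exists u, [/\ size u = n, A u & forall v, size v = n -> lexlt v u -> ~ A v].
Proof.
elim: n A => [|n IH] A [u [su Au]].
  by exists u; split => // v _ [j]; rewrite su.
have [[v [sv Av]]|none] := pselect (exists v, size v = n /\ A (false :: v)).
  have [|w [sw Aw Hw]] := IH (fun v => A (false :: v)); first by exists v.
  exists (false :: w); split => //; first by rewrite /= sw.
  move=> [|[] v'] //= [sv'] [[|j] //= hj [h1 h2 h3]] //; first by have := h3 0 isT.
  by apply: Hw => //; exists j => //; split => // i hi; exact: (h3 i.+1).
have [|w [sw Aw Hw]] := IH (fun v => A (true :: v)).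
  case: u su Au => [|[] u] //= [su] Au; first by exists u.
  by case: none; exists u.
exists (true :: w); split => //; first by rewrite /= sw.
move=> [|[] v'] //= [sv']; last by move=> _ Av; apply: none; exists v'.
move=> [[|j] //= hj [h1 h2 h3]] //.
by apply: Hw => //; exists j => //; split => // i hi; exact: (h3 i.+1).
Qed.

Lemma lexlt_total u v : size u = size v -> u <> v -> lexlt u v \/ lexlt v u.
Proof.
elim: u v => [|a u IH] [|b v] //= [suv] ne.
have [e|n] := eqVneq a b.
  subst b; have [|h|h] := IH v suv; first by move=> e; apply: ne; rewrite e.
  - by left; exact: lexlt_cons.
  - by right; exact: lexlt_cons.
by case: a b n ne => [] [] // _ _; [right|left]; exists 0.
Qed.

(** Of two distinct candidates the larger would be late. Hence all inputs of one length consult the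
    same table in [first_hard]. *)
Lemma first_hard_unique u v : size u = size v ->
  ~ easy u -> ~ late u -> ~ easy v -> ~ late v -> u = v.
Proof.
move=> suv hu lu hv lv; apply: contrapT => ne.
have [h|h] := lexlt_total suv ne.
- by apply: lv; exists u.
- by apply: lu; exists v.
Qed.

(** * Circuits *)

Definition cvals (x : seq bool) (C : circuit) : seq bool :=
  foldl (fun vals g => rcons vals (eval_gate x vals g)) [::] C.

Lemma cvals_rcons x C g : cvals x (rcons C g) = rcons (cvals x C) (eval_gate x (cvals x C) g).
Proof. by rewrite /cvals -cats1 foldl_cat. Qed.

Lemma size_cvals x C : size (cvals x C) = size C.
Proof. by elim/last_ind: C => // C g IH; rewrite cvals_rcons !size_rcons IH. Qed.

Lemma circ_out_nth C x : circ_out C x = nth false (cvals x C) (size C).-1.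
Proof. by rewrite /circ_out -nth_last -/(cvals x C) size_cvals. Qed.

Definition gates_ok (n : nat) (C : circuit) : Prop :=
  forall k, k < size C -> gate_ok n k (nth (GIn 0) C k).

Lemma eval_gate_ext n k x vals vals' g : gate_ok n k g ->
  (forall i, i < k -> nth false vals i = nth false vals' i) ->
  eval_gate x vals g = eval_gate x vals' g.
Proof.
by case: g => //= [a b|a b|a]; [case/and3P|case/and3P|] => ha; try move=> hb _; move=> H; rewrite !H.
Qed.

Lemma nth_cvals n C x k : gates_ok n C -> k < size C ->
  nth false (cvals x C) k = eval_gate x (cvals x C) (nth (GIn 0) C k).
Proof.
elim/last_ind: C => // C g IH ok; rewrite size_rcons ltnS => hk.
have ok' : gates_ok n C.
  by move=> i hi; have := ok i; rewrite size_rcons nth_rcons hi; apply; exact: ltnW.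
have okk : gate_ok n k (nth (GIn 0) (rcons C g) k) by apply: ok; rewrite size_rcons.
have E : eval_gate x (cvals x (rcons C g)) (nth (GIn 0) (rcons C g) k) =
         eval_gate x (cvals x C) (nth (GIn 0) (rcons C g) k).
  apply: eval_gate_ext okk _ => i hi.
  by rewrite cvals_rcons nth_rcons size_cvals (leq_trans hi hk).
rewrite E cvals_rcons !nth_rcons size_cvals; move: hk; rewrite leq_eqVlt => /orP [/eqP ->|hk].
  by rewrite ltnn eqxx.
by rewrite hk IH.
Qed.

Lemma gates_ok_rcons n C g : gates_ok n C -> gate_ok n (size C) g -> gates_ok n (rcons C g).
Proof.
move=> ok hg k; rewrite size_rcons ltnS nth_rcons leq_eqVlt => /orP [/eqP ->|h].
  by rewrite ltnn eqxx.
by rewrite h; exact: ok.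
Qed.

Lemma nth_cvals_rcons x C g k : k < size C ->
  nth false (cvals x (rcons C g)) k = nth false (cvals x C) k.
Proof. by move=> h; rewrite cvals_rcons nth_rcons size_cvals h. Qed.

Lemma last_cvals_rcons x C g :
  nth false (cvals x (rcons C g)) (size C) = eval_gate x (cvals x C) g.
Proof. by rewrite cvals_rcons nth_rcons size_cvals ltnn eqxx. Qed.

Lemma nth_cvals_cat x C D k : k < size C ->
  nth false (cvals x (C ++ D)) k = nth false (cvals x C) k.
Proof.
elim/last_ind: D => [|D g IH] h; first by rewrite cats0.
by rewrite -rcons_cat nth_cvals_rcons ?IH // size_cat ltn_addr.
Qed.

(** Building on top of an arbitrary circuit makes constructions composable, as appended gates leave
    earlier values unchanged. A nonempty [D] gives a fresh output vertex, so the two parents of a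
    binary gate are distinct, as [gate_ok] demands. *)
Definition extendable (n : nat) (F : n.-tuple bool -> bool) : Prop :=
  forall C, gates_ok n C -> exists D, [/\ gates_ok n (C ++ D), 0 < size D &
    forall x : n.-tuple bool, nth false (cvals x (C ++ D)) (size (C ++ D)).-1 = F x].

Lemma eq_extendable n (F G : n.-tuple bool -> bool) : F =1 G -> extendable F -> extendable G.
Proof.
by move=> E H C ok; have [D [h1 h2 h3]] := H C ok; exists D; split => // x; rewrite h3.
Qed.

Lemma extendable_in n (i : 'I_n) : extendable (fun x => tnth x i).
Proof.
move=> C ok; exists [:: GIn i]; rewrite cats1; split => //; first by apply: gates_ok_rcons => //=; exact: ltn_ord.
by move=> x; rewrite size_rcons last_cvals_rcons /= (tnth_nth false).
Qed.

Lemma extendable_not n (F : n.-tuple bool -> bool) :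
  extendable F -> extendable (fun x => ~~ F x).
Proof.
move=> H C ok; have [D [h1 h2 h3]] := H C ok.
have s0 : 0 < size (C ++ D) by rewrite size_cat ltn_addl.
exists (rcons D (GNot (size (C ++ D)).-1)); rewrite -rcons_cat; split.
- by apply: gates_ok_rcons => //=; rewrite prednK.
- by rewrite size_rcons.
- by move=> x; rewrite size_rcons last_cvals_rcons /= h3.
Qed.

Lemma extendable_and n (F G : n.-tuple bool -> bool) :
  extendable F -> extendable G -> extendable (fun x => F x && G x).
Proof.
move=> HF HG C ok; have [D [h1 h2 h3]] := HF C ok.
have [D' [h1' h2' h3']] := HG _ h1.
have s0 : 0 < size (C ++ D) by rewrite size_cat ltn_addl.
have s1 : size (C ++ D) < size ((C ++ D) ++ D') by rewrite [size ((C ++ D) ++ D')]size_cat; lia.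
exists (rcons (D ++ D') (GAnd (size (C ++ D)).-1 (size ((C ++ D) ++ D')).-1)).
rewrite -rcons_cat catA; split.
- by apply: gates_ok_rcons => //=; lia.
- by rewrite size_rcons.
- move=> x; rewrite size_rcons last_cvals_rcons /= h3' nth_cvals_cat ?h3 //; lia.
Qed.

(** There are no constant gates; an input and its negation yield both constants, whence [0 < n]. *)
Lemma extendable_const n b : 0 < n -> extendable (fun _ : n.-tuple bool => b).
Proof.
move=> n0; have H := extendable_in (Ordinal n0); have F := extendable_and H (extendable_not H).
case: b; [apply: eq_extendable (extendable_not F)|apply: eq_extendable F] => x;
by rewrite andbN.
Qed.

(** Disjunctive normal form. It ensures that a minimal circuit description exists. *)
Lemma extendable_all n (F : n.-tuple bool -> bool) : 0 < n -> extendable F.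
Proof.
move=> n0.
have Or (G H : n.-tuple bool -> bool) : extendable G -> extendable H -> extendable (fun x => G x || H x).
  move=> hG hH; apply: eq_extendable (extendable_not (extendable_and (extendable_not hG) (extendable_not hH))).
  by move=> x; rewrite negb_and !negbK.
have Eq (y : n.-tuple bool) : extendable (fun x => x == y).
  apply: (@eq_extendable _ (fun x => all (fun i => tnth x i == tnth y i) (enum 'I_n))).
    move=> x; apply/allP/eqP => [H|-> //]; apply: eq_from_tnth => i.
    by apply/eqP/H; rewrite mem_enum.
  elim: (enum 'I_n) => [|i s IH] /=; first exact: extendable_const.
  apply: extendable_and IH; case: (tnth y i).
    by apply: eq_extendable (extendable_in i) => x; case: (tnth x i).
  by apply: eq_extendable (extendable_not (extendable_in i)) => x; case: (tnth x i).
apply: (@eq_extendable _ (fun x => has (fun y => F y && (x == y)) (enum {: n.-tuple bool}))).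
  move=> x; apply/hasP/idP => [[y _ /andP [h /eqP ->]] //|h].
  by exists x; rewrite ?mem_enum ?h ?eqxx.
elim: (enum _) => [|y s IH] /=; first exact: extendable_const.
apply: Or IH; case: (F y) => /=; [exact: Eq|exact: extendable_const].
Qed.

Definition used (C : circuit) (j : nat) : bool :=
  has (fun k => gate_parent (nth (GIn 0) C k) j) (iota j.+1 (size C - j.+1)).

Lemma usedP C j : reflect (exists k, [/\ j < k, k < size C & gate_parent (nth (GIn 0) C k) j])
  (used C j).
Proof.
apply: (iffP hasP) => [[k]|[k [h1 h2 h3]]].
  by rewrite mem_iota => h hp; exists k; split => //; lia.
by exists k => //; rewrite mem_iota; lia.
Qed.

(* Vertices left dangling are absorbed, one at a time, by or-ing [j && ~~ j] into the output. *)
Lemma wf_circuit_exists n (F : n.-tuple bool -> bool) : 0 < n -> exists C, circ_computes C F.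
Proof.
move=> n0; have ok0 : gates_ok n [::] by [].
have [C [ok]] := extendable_all F n0 ok0.
rewrite /= => s0 HC.
(* After [j] rounds only the output and the old vertices from [j] on can dangle; each round also
   consumes the previous output. *)
have Inv j : j <= (size C).-1 -> exists C', [/\ gates_ok n C', size C <= size C',
    forall x : n.-tuple bool, nth false (cvals x C') (size C').-1 = F x &
    forall i, i < (size C').-1 -> (j <= i < (size C).-1) \/ used C' i].
  elim: j => [|j IH] hj.
    by exists C; split => // i hi; left; rewrite leq0n.
  have [C' [h1 h2 h3 h4]] := IH (ltnW hj).
  set m := size C'.
  pose C1 := rcons C' (GNot j); pose C2 := rcons C1 (GAnd j m).
  pose C3 := rcons C2 (GOr m.-1 m.+1).
  have z1 : size C1 = m.+1 by rewrite size_rcons.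
  have z2 : size C2 = m.+2 by rewrite size_rcons z1.
  have z3 : size C3 = m.+3 by rewrite size_rcons z2.
  have jm : j < m by rewrite /m; lia.
  have ok1 : gates_ok n C1 by apply: gates_ok_rcons.
  have ok2 : gates_ok n C2 by apply: gates_ok_rcons => //=; rewrite z1; lia.
  have ok3 : gates_ok n C3 by apply: gates_ok_rcons => //=; rewrite z2; lia.
  have N3 i : nth (GIn 0) C3 i = if i < m then nth (GIn 0) C' i else
      if i == m then GNot j else if i == m.+1 then GAnd j m else
      if i == m.+2 then GOr m.-1 m.+1 else GIn 0.
    rewrite !nth_rcons z2 z1 -/m; case: (ltnP i m.+2) => [h|h].
      case: (ltnP i m.+1) => h'.
        case: (ltnP i m) => h2' //; have e : i = m by lia.
        by rewrite e eqxx.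
      have e : i = m.+1 by lia.
      by rewrite e eqxx ltnNge leqnSn /= gtn_eqF.
    have -> : i < m = false by lia.
    have -> : i == m = false by lia.
    by have -> : i == m.+1 = false by lia.
  have Na : nth (GIn 0) C3 m.+1 = GAnd j m by rewrite N3 ltnNge leqnSn gtn_eqF //= eqxx.
  have No : nth (GIn 0) C3 m.+2 = GOr m.-1 m.+1.
    rewrite N3; have -> : m.+2 < m = false by lia.
    have -> : m.+2 == m = false by lia.
    have -> : m.+2 == m.+1 = false by lia.
    by rewrite eqxx.
  have U i k : i < k -> k < m.+3 -> gate_parent (nth (GIn 0) C3 k) i -> used C3 i.
    by move=> ik km hp; apply/usedP; exists k; rewrite z3.
  exists C3; split=> //; first by rewrite z3 /m in h2 *; lia.
    move=> x; rewrite z3 /= /C3 -z2 last_cvals_rcons /= /C2 -z1 last_cvals_rcons /=.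
    rewrite nth_cvals_rcons ?z1; last by lia.
    rewrite /C1 [nth _ (cvals x (rcons C' _)) m]last_cvals_rcons.
    by rewrite !nth_cvals_rcons /=; [rewrite andbN orbF h3|rewrite -/m; lia..].
  move=> i; rewrite z3 /= ltnS => hi.
  have [->|ne] := eqVneq i j; first by right; apply: (U _ m); rewrite ?N3 ?ltnn ?eqxx /= ?eqxx; lia.
  have [hi'|hi'] := ltnP i m.-1.
    have [h|/usedP [k [k1 k2 k3]]] := h4 i hi'; first by left; lia.
    by right; apply: (U _ k) => //; [rewrite -/m in k2; lia|rewrite N3 k2].
  right; have [e|ne1] := eqVneq i m.-1.
    by apply: (U _ m.+2); rewrite ?No /= ?e ?eqxx //; lia.
  have [e|ne2] := eqVneq i m.
    by apply: (U _ m.+1); rewrite ?Na /= ?e ?eqxx ?orbT //; lia.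
  have e : i = m.+1 by lia.
  by apply: (U _ m.+2); rewrite ?No /= ?e ?eqxx ?orbT //; lia.
have [C' [h1 h2 h3 h4]] := Inv _ (leqnn _).
exists C'; split; last by move=> x; rewrite circ_out_nth h3.
apply/and3P; split; first by lia.
- by apply/allP => k; rewrite mem_iota => hk; apply: h1; lia.
- apply/allP => j; rewrite mem_iota => hj; have [|//|//] := h4 j; first by lia.
  by move=> ?; lia.
Qed.

(** * Counting *)

Definition three (n a b c : nat) : n.-tuple bool :=
  [tuple [|| (i : nat) == a, (i : nat) == b | (i : nat) == c] | i < n].

Lemma nth_three n a b c i : i < n -> nth false (three n a b c) i = [|| i == a, i == b | i == c].
Proof. by move=> h; rewrite -(tnth_nth false _ (Ordinal h)) tnth_mktuple. Qed.

(** The case [p = q] serves vertices that depend on a single parent or a single input bit. *)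
Lemma all_pair_iota (R : pred nat) k p q : p < k -> q < k ->
  all (fun j => ((j == p) || (j == q)) ==> R j) (iota 0 k) = R p && R q.
Proof.
move=> hp hq; apply/all_iotaP/andP => [H|[rp rq] j _].
  by have := H p hp; have := H q hq; rewrite !eqxx orbT.
by apply/implyP => /orP [/eqP ->|/eqP ->].
Qed.

(** Every gate is a conjunction up to complement: OR by De Morgan from negated parents with [tau]
    set, NOT as a conjunction of one negated parent, an input as a conjunction of one bit. *)
Lemma easy_of_circuit n (f : n.-tuple bool -> bool) C T :
  circ_computes C f -> size C ^ 3 <= n ^ 4 ->
  (forall a b c, a < b -> b < c -> c < n -> f (three n a b c) = T a b c) ->
  easy_table n T.
Proof.
case=> /and3P [s0 /allP ok _] Hf hs HT.
have {}ok : gates_ok n C by move=> k hk; apply: ok; rewrite mem_iota.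
pose g k := nth (GIn 0) C k.
exists (size C),
  (fun k j => if g k is GAnd a b then (j == a) || (j == b) else false),
  (fun k j => match g k with GOr a b => (j == a) || (j == b) | GNot a => (j == a) || (j == a) | _ => false end),
  (fun k j => if g k is GIn i then (j == i) || (j == i) else false),
  (fun k => if g k is GOr _ _ then true else false),
  (fun k a b c => nth false (cvals (three n a b c) C) k).
split=> // [k a b c hk ha hb hc|a b c ab bc cn]; last first.
  by rewrite -HT // -Hf circ_out_nth.
have AT m : all (fun _ : nat => true) (iota 0 m) by apply/allP.
rewrite /gate_at (nth_cvals _ ok hk) -/(g k); have := ok k hk; rewrite -/(g k).
set v := cvals _ _; case: (g k) => [i|p q|p q|p] /=.
- move=> hi; rewrite AT all_pair_iota //= nth_three // andbb; by case: [|| _, _ | _].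
- case/and3P => hp hq _; under eq_all do rewrite andbT.
  by rewrite all_pair_iota // AT andbT; do 2 case: nth.
- case/and3P => hp hq _; rewrite all_pair_iota // AT andbT; by do 2 case: nth.
- by move=> hp; rewrite all_pair_iota // AT andbT andbb; case: nth.
Qed.

Lemma gate_at_eq n P Q I tau P' Q' I' tau' V k a b c :
  (forall j, j < k -> P k j = P' k j) -> (forall j, j < k -> Q k j = Q' k j) ->
  (forall j, j < n -> I k j = I' k j) -> tau k = tau' k ->
  gate_at n P Q I tau V k a b c = gate_at n P' Q' I' tau' V k a b c.
Proof.
move=> hP hQ hI ht; rewrite /gate_at ht; congr (_ == ~~ (_ == _ && _));
apply: eq_in_all => j; rewrite mem_iota add0n => /andP [_ h]; by rewrite ?hP ?hQ ?hI.
Qed.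

(** A vertex refers only to earlier ones, so the matrices determine all values, and [V] costs no
    bits in the count. *)
Lemma gate_at_determined n P Q I tau V V' s a b c :
  (forall k, k < s -> gate_at n P Q I tau V k a b c) ->
  (forall k, k < s -> gate_at n P Q I tau V' k a b c) ->
  forall k, k < s -> V k a b c = V' k a b c.
Proof.
move=> H H' k; have [m] := ubnP k; elim: m k => // m IH k km ks.
rewrite (eqP (H k ks)) (eqP (H' k ks)); congr (~~ (_ == _ && _)).
by apply: eq_in_all => j; rewrite mem_iota add0n => /andP [_ h]; rewrite IH //; lia.
Qed.

Definition lookup A B (F : {ffun 'I_A * 'I_B -> bool}) (k j : nat) : bool :=
  if insub k is Some k' then if insub j is Some j' then F (k', j') else false else false.

Lemma lookup_ffun A B (P : nat -> nat -> bool) k j : k < A -> j < B ->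
  lookup [ffun p : 'I_A * 'I_B => P p.1 p.2] k j = P k j.
Proof.
by move=> hk hj; rewrite /lookup (insubT (fun i => i < A) hk) (insubT (fun i => i < B) hj) ffunE.
Qed.

Lemma triple_inj n a b c a' b' c' : b < n -> c < n -> b' < n -> c' < n ->
  (a * n + b) * n + c = (a' * n + b') * n + c' -> [/\ a = a', b = b' & c = c'].
Proof.
move=> hb hc hb' hc' E.
have n0 : 0 < n by lia.
have e1 : c = c' by rewrite -(modn_small hc) -(modn_small hc') -(modnMDl (a * n + b)) E modnMDl.
have e2 : a * n + b = a' * n + b'.
  by apply/eqP; rewrite -(eqn_pmul2r n0); apply/eqP; move: E; rewrite e1 => /addIn.
have e3 : b = b' by rewrite -(modn_small hb) -(modn_small hb') -(modnMDl a) e2 modnMDl.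
split=> //; apply/eqP; rewrite -(eqn_pmul2r n0); apply/eqP; move: e2; rewrite e3; exact: addIn.
Qed.

(* An easy table is determined by fewer bits than it has independent entries,
   namely those at [a < h <= b < 2 h <= c < 3 h] with [h = q ^ 3]. *)
Lemma hard_table_exists q : 76 <= q ->
  exists u, size u = (3 * q ^ 3) ^ 3 /\ ~ easy u.
Proof.
move=> hq; apply: contrapT => none; set n := 3 * q ^ 3 in none *.
have all_easy u : size u = n ^ 3 -> easy u.
  by move=> su; apply: contrapT => h; apply: none; exists u.
(* [n ^ 4 = 81 * q ^ 12] is at most [125 * q ^ 12 = S ^ 3], so a circuit allowed by [easy_table] has
   at most [S] vertices. *)
pose h := q ^ 3; pose S := 5 * q ^ 4.
have nh : n = 3 * h by [].
pose TT := {ffun 'I_h * 'I_h * 'I_h -> bool}.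
pose code : finType := ('I_S.+1 * {ffun 'I_S * 'I_S -> bool} * {ffun 'I_S * 'I_S -> bool} *
  {ffun 'I_S * 'I_n -> bool} * {ffun 'I_S * 'I_1 -> bool})%type.
pose D (T : TT) (z : code) := let: (s, P, Q, J, tau) := z in exists V,
  [/\ 0 < s, forall k a b c, k < s -> a < n -> b < n -> c < n ->
        gate_at n (lookup P) (lookup Q) (lookup J) (fun k => lookup tau k 0) V k a b c &
      forall a b c : 'I_h, V s.-1 a (h + b) (2 * h + c) = T (a, b, c)].
have DD T : exists z, D T z.
  (* A prescribed [T] is planted at the triples with one member in each of three consecutive blocks
     of length [h]; such triples are increasing. All other entries are false. *)
  pose u := mkseq (fun i => `[< exists a b c : 'I_h,
    i = (a * n + (h + b)) * n + (2 * h + c) /\ T (a, b, c) >]) (n ^ 3).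
  have su : size u = n ^ 3 by rewrite size_mkseq.
  have [n' /eqP] := all_easy u su; rewrite su eqn_exp2r // => /eqP ->.
  case=> s [P [Q [J [tau [V [s0 s3 HG HO]]]]]].
  have sS : s <= S.
    rewrite -(@leq_exp2r _ _ 3) //; apply: leq_trans s3 _.
    by rewrite /n /S (expnMn 3) (expnMn 5) -!expnM leq_mul2r orbT.
  have sS' : s < S.+1 by [].
  exists (Ordinal sS', [ffun p : 'I_S * 'I_S => P p.1 p.2], [ffun p : 'I_S * 'I_S => Q p.1 p.2],
     [ffun p : 'I_S * 'I_n => J p.1 p.2],
     [ffun p : 'I_S * 'I_1 => (fun k _ => tau k) (p.1 : nat) (p.2 : nat)]).
  exists V; split => //= [k a b c hk ha hb hc|a b c].
    have kS := leq_trans hk sS.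
    rewrite (@gate_at_eq _ _ _ _ _ P Q J tau) ?HG // => [j hj|j hj|j hj|].
    - by rewrite (lookup_ffun P) // (ltn_trans hj).
    - by rewrite (lookup_ffun Q) // (ltn_trans hj).
    - by rewrite (lookup_ffun J).
    - by rewrite (lookup_ffun (fun k _ => tau k)).
  have ha := ltn_ord a; have hb := ltn_ord b; have hc := ltn_ord c.
  rewrite HO; try by rewrite ?nh; lia.
  rewrite /table_of nth_mkseq; last first.
    rewrite !expnS expn0 muln1 mulnA; have h1 : h + b < n by rewrite nh; lia.
    have h2 : a < n by rewrite nh; lia.
    have h3 : 2 * h + c < n by rewrite nh; lia.
    have : a * n + (h + b) < n * n by nia.
    by nia.
  apply/asboolP/idP => [[a' [b' [c' [e hT]]]]|hT]; last by exists a, b, c.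
  have ha' := ltn_ord a'; have hb' := ltn_ord b'; have hc' := ltn_ord c'.
  have [| | | |e1 e2 e3] := triple_inj _ _ _ _ e; try by rewrite nh; lia.
  have <- : a' = a by apply: val_inj; rewrite /= e1.
  have <- : b' = b by apply: val_inj => /=; lia.
  by have <- : c' = c by apply: val_inj => /=; lia.
have [f Hf] := choice DD.
have inj : injective f.
  move=> T T' E; have := Hf T; have := Hf T'; rewrite -E.
  case: (f T) => [[[[s P] Q] J] tau] [V' [s0 HG' HO']] [V [_ HG HO]].
  apply/ffunP => -[[a b] c]; rewrite -HO -HO'.
  have ha := ltn_ord a; have hb := ltn_ord b; have hc := ltn_ord c.
  apply: (@gate_at_determined n (lookup P) (lookup Q) (lookup J) (fun k => lookup tau k 0) _ _ s).
  - by move=> k hk; apply: HG => //; rewrite nh; lia.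
  - by move=> k hk; apply: HG' => //; rewrite nh; lia.
  - by rewrite prednK.
have := leq_card f inj.
rewrite !card_prod !card_ffun !card_prod !card_ord !card_bool muln1.
move=> H.
(* The exponent counts the bits of a code: [S] for the number of vertices, [S * S] for each of [P]
   and [Q], [S * n] for [J] and [S] for [tau]. *)
have : 2 ^ (h * h * h) <= 2 ^ (S + S * S + S * S + S * n + S).
  apply: leq_trans H _; move: (S) => s; move: (s * s) (s * n) => A B.
  by rewrite !expnD; do 4 (apply: leq_mul => //); exact: ltn_expl.
rewrite leq_exp2l // nh /S /h => {H}.
have -> : q ^ 4 = q * q ^ 3 by rewrite expnS.
have -> : q ^ 3 = q * q * q by rewrite !expnS expn0 muln1 mulnA.
set y := q * q * q => H.
have y0 : 0 < y by rewrite /y !muln_gt0; lia.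
(* With [y = q ^ 3] the bits number 10 q^4 + 50 q^8 + 15 q^7, at most 75 q^8, which is below q^9 as
   soon as [76 <= q]. *)
have h1 : 76 * (q * q * y * y) <= y * y * y.
  have -> : y * y * y = q * (q * q * y * y) by rewrite {1}/y; lia.
  by rewrite leq_mul2r hq orbT.
have h2 : q * y <= q * q * y * y by nia.
have h3 : q * y * y <= q * q * y * y by nia.
have h4 : 0 < q * q * y * y by rewrite !muln_gt0 -/y; lia.
have : y * y * y <= 10 * (q * y) + 50 * (q * q * y * y) + 15 * (q * y * y) by lia.
lia.
Qed.

(** * The contradiction *)

Lemma is_min_exists (P : nat -> Prop) : (exists k, P k) -> exists m, is_min P m.
Proof.
case=> k; have [m] := ubnP k; elim: m k => // m IH k km Pk.
have [[j [jk Pj]]|none] := pselect (exists j, j < k /\ P j); first by apply: (IH j) => //; lia.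
by exists k; split => // j Pj; rewrite leqNgt; apply/negP => h; apply: none; exists j.
Qed.

Lemma Rpower_sixth_eventually (B : R) : Rlt 0 B -> exists N, forall n, N <= n ->
  0 < n /\ Rle B (Rpower (INR n) (Rdiv 1 6)).
Proof.
move=> B0; exists (Z.to_nat (up (pow B 6))).+1 => n hn; split; first by lia.
have [up1 _] := archimed (pow B 6).
have B6 : Rlt 0 (pow B 6) by exact: pow_lt.
have hz : (0 <= up (pow B 6))%Z by apply: le_IZR; apply: Rlt_le; apply: Rlt_trans up1.
have hB : Rle (pow B 6) (INR n).
  apply: Rle_trans (Rlt_le _ _ up1) _; rewrite -(Z2Nat.id _ hz) -INR_IZR_INZ.
  by apply: le_INR; lia.
have -> : B = Rpower (pow B 6) (Rdiv 1 6).
  rewrite -(Rpower_pow 6 _ B0) Rpower_mult.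
  have -> : Rmult (INR 6) (Rdiv 1 6) = IZR 1 by rewrite /=; field.
  by rewrite Rpower_1.
by apply: Rle_Rpower_l; [lra|split].
Qed.

(** Since 4/3 = 7/6 + 1/6, the spare factor n^(1/6) eventually exceeds the constant [A]. *)
Lemma cube_le_of_Rle (A : R) : exists N, forall n s, N <= n ->
  Rle (INR s) (Rmult A (Rpower (INR n) (Rplus 1 (Rdiv 1 6)))) -> s ^ 3 <= n ^ 4.
Proof.
have B0 : Rlt 0 (Rmax A 1) by apply: (Rlt_le_trans _ 1); [lra|exact: Rmax_r].
have [N HN] := Rpower_sixth_eventually B0; exists N => n s /HN [n0 hB] hs.
have nR : Rlt 0 (INR n) by apply: (lt_INR 0); lia.
set p := Rpower (INR n) (Rplus 1 (Rdiv 1 6)) in hs.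
have p0 : Rlt 0 p by exact: exp_pos.
have h : Rle (INR s) (Rpower (INR n) (Rdiv 4 3)).
  have -> : Rdiv 4 3 = Rplus (Rdiv 1 6) (Rplus 1 (Rdiv 1 6)) by field.
  rewrite Rpower_plus -/p; apply: Rle_trans hs _; apply: Rmult_le_compat_r; first exact: Rlt_le.
  by apply: Rle_trans hB; exact: Rmax_l.
have h3 : Rle (pow (INR s) 3) (pow (INR n) 4).
  have -> : pow (INR n) 4 = pow (Rpower (INR n) (Rdiv 4 3)) 3.
    rewrite -(Rpower_pow 3) ?Rpower_mult; last exact: exp_pos.
    have -> : Rmult (Rdiv 4 3) (INR 3) = INR 4 by rewrite /=; field.
    by rewrite Rpower_pow.
  by apply: pow_incr; split => //; exact: pos_INR.
move: h3; rewrite -!pow_INR !Nat_powE => /INR_le; lia.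
Qed.

Lemma circ_len_ge s n : s <= circ_len s n.
Proof. by rewrite /circ_len; apply: leq_trans (leq_addl _ _); rewrite leq_pmulr // addSn. Qed.

Theorem mainTheorem14
  (U : nat -> interpreter)
  (* U^c outputs bottom unless p = E(T)u, and |E(T)| >= 2 *)
  (HUvalid : forall (c : nat) (p x : seq bool), U c p x <> None -> 2 <= size p)
  (* universality of the time-bounded interpreter U^c *)
  (HUuniv : forall (c : nat), 0 < c ->
     forall (M : TM) (g : seq bool -> bool) (c' : nat), c' < c ->
       computes_in_time M g c' ->
       exists (h : seq bool) (N : nat),
         forall x : seq bool, N <= size x -> U c h x = Some (g x))
  (Hyp : forall (c : nat), 0 < c -> forall gamma : R, Rlt 0 gamma ->
     exists (K : R) (N : nat), forall n : nat, N <= n ->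
       forall (f : n.-tuple bool -> bool) (mU mC : nat),
         is_min (prog_len (U c) f) mU ->
         is_min (circ_desc_len f) mC ->
         Rle (Rdiv (INR mC) (INR mU)) (Rmult K (Rpower (INR n) (Rplus 1 gamma)))) :
  P_class <> NP_class.
Proof.
move=> E; have [L [M [d HM]] HL] := first_hard_P E.
(* Universality asks for an exponent strictly above [d]. The program [h] does not depend on n, so
   its length bounds the description lengths of all long enough slices of [L]. *)
have [h [N0 Hh]] := HUuniv d.+1 isT M L d (ltnSn d) HM.
have g0 : Rlt 0 (Rdiv 1 6) by lra.
have [K [N1 HK]] := Hyp d.+1 isT _ g0.
(* [K] may be negative; [Rmax K 0] keeps the product monotone when [mU] is replaced by its bound
   [size h]. *)
have [N2 HN2] := cube_le_of_Rle (Rmult (Rmax K 0) (INR (size h))).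
(* [q] is at least 76, as the count demands, and at least each threshold; [n] inherits the
   thresholds from [q <= n]. *)
pose q := 76 + N0 + N1 + N2; pose n := 3 * q ^ 3.
have qn : q <= n.
  by apply: (@leq_trans (q ^ 3)); [rewrite -{1}(expn1 q) leq_pexp2l|rewrite leq_pmull].
have n0 : 0 < n by rewrite /q in qn; lia.
have [v [sv hv]] : exists u, size u = n ^ 3 /\ ~ easy u by apply: hard_table_exists; rewrite /q; lia.
have [|u [su hu umin]] := @lexmin_exists (n ^ 3) (fun u => ~ easy u); first by exists v.
have lu : ~ late u.
  by case=> u' [su' lt hu']; apply: (umin u') => //; rewrite su' su.
pose f (x : n.-tuple bool) := L x.
have Uf x : U d.+1 h (tval x) = Some (f x) by apply: Hh; rewrite size_tuple /q in qn *; lia.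
have [|mU [[p [sp Hp]] minU]] := @is_min_exists (prog_len (U d.+1) f).
  by exists (size h), h.
(* A positive [mU] makes the real quotient genuine, so that it can be multiplied out. *)
have mU2 : 2 <= mU.
  by rewrite -sp; apply: (HUvalid d.+1 p [tuple false | _ < n]); rewrite Hp.
have mUh : mU <= size h by apply: minU; exists h.
have [|mC [[C [HC sC]] minC]] := @is_min_exists (circ_desc_len f).
  by have [C HC] := wf_circuit_exists f n0; exists (circ_len (size C) n), C.
have HR := HK n _ f mU mC (conj (ex_intro _ p (conj sp Hp)) minU) (conj (ex_intro _ C (conj HC sC)) minC).
have {}HR : Rle (Rdiv (INR mC) (INR mU)) (Rmult K (Rpower (INR n) (Rplus 1 (Rdiv 1 6)))).
  by apply: HR; rewrite /q in qn; lia.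
(* The contradiction is that [u] turns out to be easy, by a minimal circuit for [f]. *)
apply: (hu); exists n => //; apply: (easy_of_circuit HC).
  apply: HN2; first by rewrite /q in qn; lia.
  set P := Rpower _ _ in HR *; have P0 : Rlt 0 P by exact: exp_pos.
  have mU0 : Rlt 0 (INR mU) by apply: (lt_INR 0); lia.
  apply: (Rle_trans _ (INR mC)); first by apply: le_INR; have := circ_len_ge (size C) n; rewrite sC; lia.
  have -> : INR mC = Rmult (Rdiv (INR mC) (INR mU)) (INR mU) by field; lra.
  apply: Rle_trans (Rmult_le_compat_r _ _ _ (Rlt_le _ _ mU0) HR) _.
  have hm : Rle (INR mU) (INR (size h)) by apply: le_INR; lia.
  have k0 := Rmax_r K 0; have k1 := Rmax_l K 0.
  apply: (Rle_trans _ (Rmult (Rmult (Rmax K 0) P) (INR mU))).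
    by apply: Rmult_le_compat_r; [lra|apply: Rmult_le_compat_r; lra].
  have -> : Rmult (Rmult (Rmax K 0) (INR (size h))) P = Rmult (Rmult (Rmax K 0) P) (INR (size h)) by ring.
  by apply: Rmult_le_compat_l => //; apply: Rmult_le_pos; lra.
move=> a b c ab bc cn.
have bn := ltn_trans bc cn; have an := ltn_trans ab bn.
rewrite /f; apply/idP/idP => [/HL [u' [su' hu' lu' [a' [b' [c' [ab' bc' cn' hx hT]]]]]]|hT].
  rewrite size_tuple in su' cn' hT.
  have eu : u' = u by apply: (first_hard_unique _ hu' lu' hu lu); rewrite su'.
  have bn' := ltn_trans bc' cn'; have an' := ltn_trans ab' bn'.
  move: hx; rewrite !nth_three // => /and3P [h1 h2 h3].
  (* An increasing triple with members among [a < b < c] is that triple. *)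
  have [e1 [e2 e3]] : a' = a /\ b' = b /\ c' = c by lia.
  by rewrite -e1 -e2 -e3 -eu.
apply/HL; exists u; rewrite size_tuple; split => //.
exists a, b, c; split => //.
by rewrite !nth_three // !eqxx !orbT.
Qed.
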